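(* For $n \in \mathbb{N}$ let $A_n \in \mathbb{R}^{n\times n}$ be the Redheffer matrix and $v_n \in \mathbb{R}^n$ the vector $(v_n)_k = \sigma(k)/k = \sum_{d\mid k} 1/d$ for $1 \le k \le n$. Then the limit $$\alpha = \lim_{n\to\infty} \left\langle \frac{v_n}{\|v_n\|}, \frac{A_n^T A_n v_n}{\|A_n^T A_n v_n\|}\right\rangle$$ exists, and $$\alpha = \frac{\sqrt{2}}{\sqrt{5}\sqrt{\zeta(3)}}\left(\sum_{d=1}^\infty \frac{c_d^2}{d^2}\right)\left(\sum_{d_1,d_2=1}^\infty \frac{c_{d_1}c_{d_2}\gcd(d_1,d_2)}{d_1^2 d_2^2}\right)^{-1/2},$$ where $c_d = \sum_{m=1}^\infty \gcd(m,d)/m^2$ and $\zeta$ is the Riemann zeta function. Numerically $\alpha \approx 0.9979$.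
   Context: The Redheffer matrix $A_n=(A_{ij})_{i,j=1}^n$ has $A_{ij}=1$ if $j=1$ or $i \mid j$, and $A_{ij}=0$ otherwise. $\sigma(k)$ denotes the sum of all positive divisors of $k$. $\|\cdot\|$ is the Euclidean norm and $\langle\cdot,\cdot\rangle$ the standard inner product on $\mathbb{R}^n$. *)

(* Defs.v *)
From HB Require Import structures.
From mathcomp Require Export all_boot all_order all_algebra.
From mathcomp Require Export all_classical all_reals all_analysis.

Set Implicit Arguments.
Unset Strict Implicit.
Unset Printing Implicit Defensive.

Import Order.TTheory GRing.Theory Num.Theory.
Import numFieldNormedType.Exports.

Local Open Scope classical_set_scope.
Local Open Scope ring_scope.

(* Ordinals count from 0: the index i : 'I_n stands for i.+1 in {1, ..., n}. *)

Definition redheffer (R : realType) (n : nat) : 'M[R]_n :=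
  \matrix_(i < n, j < n) ((j.+1 == 1)%N || (i.+1 %| j.+1)%N)%:R.

Definition sigma (k : nat) : nat := (\sum_(d <- divisors k) d)%N.

Definition sigma_vec (R : realType) (n : nat) : 'cV[R]_n :=
  \col_(k < n) ((sigma k.+1)%:R / k.+1%:R).

Lemma sigma_vecE (R : realType) (n : nat) (k : 'I_n) :
  sigma_vec R n k 0 = \sum_(d <- divisors k.+1) (d%:R)^-1.
Proof.
rewrite mxE /sigma natr_sum mulr_suml.
have inj : {in divisors k.+1, forall d, (k.+1 %/ d) \in divisors k.+1}%N.
  by move=> d; rewrite -!dvdn_divisors // => dk; apply: dvdn_div.
have invol : {in divisors k.+1, forall d, k.+1 %/ (k.+1 %/ d) = d}%N.
  by move=> d; rewrite -dvdn_divisors // => dk; rewrite divnA // mulKn.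
have injd : {in divisors k.+1 &, injective (fun d => k.+1 %/ d)%N}.
  by move=> a b ha hb /= e; rewrite -(invol a) // -(invol b) // e.
have perm : perm_eq (divisors k.+1) [seq (k.+1 %/ d)%N | d <- divisors k.+1].
  apply: uniq_perm; rewrite ?map_inj_in_uniq ?divisors_uniq //.
  move=> d; apply/idP/mapP => [hd|[e he ->]]; last exact: inj.
  by exists (k.+1 %/ d)%N; [exact: inj | rewrite invol].
rewrite (perm_big _ perm) /= big_map big_seq [RHS]big_seq.
apply: eq_bigr => d; rewrite -dvdn_divisors // => dk.
have d0 : (0 < d)%N by exact: dvdn_gt0 dk.
rewrite -{2}(divnK dk) natrM invfM mulVKf // pnatr_eq0 -lt0n divn_gt0 //.
exact: dvdn_leq.
Qed.

(* The library norm on matrices is the sup norm, hence these definitions. *)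

Definition inner (R : realType) (n : nat) (u v : 'cV[R]_n) : R :=
  \sum_(i < n) u i 0 * v i 0.

Definition enorm (R : realType) (n : nat) (u : 'cV[R]_n) : R :=
  Num.sqrt (inner u u).

(* The Dirichlet series, which is the Riemann zeta function for real s > 1. *)
Definition zeta (R : realType) (s : R) : R :=
  limn (fun N => \sum_(1 <= k < N) (k%:R : R) `^ (- s)).

Definition gcd_coef (R : realType) (d : nat) : R :=
  limn (fun N => \sum_(1 <= m < N) ((gcdn m d)%:R / m%:R ^+ 2 : R)).

(* The unordered sum over all d1, d2 >= 1, with values in [0, +oo]. *)
Definition gcd_form (R : realType) : \bar R :=
  (\esum_(p in [set p : nat * nat | (0 < p.1)%N /\ (0 < p.2)%N])
     (gcd_coef R p.1 * gcd_coef R p.2 * (gcdn p.1 p.2)%:R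
        / (p.1%:R ^+ 2 * p.2%:R ^+ 2))%:E)%E.

(* Main.v *)
Require Import Defs.
From mathcomp Require Import cyclic.
From mathcomp Require Import ring lra zify.
Import Order.TTheory GRing.Theory Num.Theory.
Import numFieldNormedType.Exports.
Set Implicit Arguments.
Unset Strict Implicit.
Unset Printing Implicit Defensive.

Local Open Scope classical_set_scope.
Local Open Scope ring_scope.

(* Write c_d for gcd_coef and A_n for the Redheffer matrix.  For fixed i the
   entry (A_n v_n)_i is n c_i / i + o(n), and it is at most 2 n c_i / i for all
   i <= n.  Hence, by dominated convergence for series, |v|^2 / n,
   <v, A^T A v> / n^2 = |A v|^2 / n^2 and |A^T A v|^2 / n^3 converge to
   V = sum gcd(a,b) / (a b)^2, S = sum c_d^2 / d^2 and
   G = sum c_a c_b gcd(a,b) / (a b)^2; the first column of A_n only matters in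
   one entry of A^T A v, which is o(n^(3/2)).

   Expanding gcd(a,b) as the sum of phi(e) over the common divisors e gives,
   with w(q) = phi(q) / q^4 and h(q) = sum_e w(e) gcd(e,q)^2,
     V = zeta(2)^2 A,  S = zeta(2)^3 B,  G = zeta(2)^4 C
   where A = sum w, B = sum w h, C = sum w h^2.  So A zeta(4) = zeta(3), and
   2 zeta(2)^2 = 5 zeta(4) yields V = 5/2 zeta(3), while alpha = B / sqrt (A C)
   is the cosine of the angle between 1 and h in l^2(w).

   As w and h / h(1) are multiplicative, alpha^2 is an Euler product whose
   factor at p is 1 - O(p^-5).  The factors at 2, 3, 5, 7 are computed exactly.
   Over the integers prime to 210 the Cauchy-Schwarz inequality bounds the rest
   by 1, and the variance of h is small enough for the lower bound. *)

(** * Sums of nonnegative families *)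

(** The argument is a chain of exchanges of infinite sums, so all sums are kept nonnegative and
    unordered; a signed sum is always written as a difference of two nonnegative ones. Summability
    comes from comparison with sum k^(-5/4), or with the product of two copies of it. The obstacle
    is that gcd(m, n) is unbounded: interpolating it as m^(3/4) n^(1/4) or as sqrt(m n) leaves
    enough decay for the majorants. Sums run over all of [nat]; the index 0 contributes nothing
    because the inverse of 0 is 0.

    The number of exact Euler factors is dictated by the upper bound: the four upper estimates
    multiply to about 0.995997, against 0.998^2 = 0.996004, and the prime 7 alone contributes
    3.6e-5. Over the integers prime to 210 every nontrivial gcd is at least 11, so h stays close to
    its least value h(1) = A there. The variance is therefore measured around A, which needs no
    knowledge of the mean B / A. *)

(** A relation rather than a value: it carries nonnegativity and finiteness together with the sum,
    so exchanging, reindexing and comparing sums never produces separate summability goals. *)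
Definition hsum (R : realType) (T : choiceType) (f : T -> R) (l : R) : Prop :=
  (forall i, 0 <= f i) /\ (\esum_(i in [set: T]) (f i)%:E = l%:E)%E.

Lemma hsum_uniq (R : realType) (T : choiceType) (f : T -> R) l m :
  hsum f l -> hsum f m -> l = m.
Proof. by move=> [_ fl] [_]; rewrite fl => -[]. Qed.

Lemma hsum_ext (R : realType) (T : choiceType) (f g : T -> R) l :
  (forall i, f i = g i) -> hsum f l -> hsum g l.
Proof. by move=> /funext ->. Qed.

Lemma hsum_ge0 (R : realType) (T : choiceType) (f : T -> R) l :
  hsum f l -> 0 <= l.
Proof.
by move=> [f0 fl]; rewrite -lee_fin -fl esum_ge0// => i _; rewrite lee_fin.
Qed.

Lemma hsum_seq_le (R : realType) (T : choiceType) (f : T -> R) l (s : seq T) :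
  hsum f l -> uniq s -> \sum_(i <- s) f i <= l.
Proof.
move=> [f0 fl] us; rewrite -lee_fin -fl; apply: esum_ge.
exists [set` s]; first by split => //; exact: finite_seq.
by rewrite -fsbig_seq// sumEFin.
Qed.

Lemma hsum_char (R : realType) (T : choiceType) (f : T -> R) l :
  (forall i, 0 <= f i) ->
  (forall s : seq T, uniq s -> \sum_(i <- s) f i <= l) ->
  (forall e, 0 < e -> exists2 s : seq T, uniq s & l - e <= \sum_(i <- s) f i) ->
  hsum f l.
Proof.
move=> f0 ub lb; split => //; apply/eqP; rewrite eq_le; apply/andP; split.
  apply: ge_ereal_sup => _ [X [finX _] <-].
  by rewrite fsbig_finite//= sumEFin lee_fin ub// fset_uniq.
apply/lee_addgt0Pr => e e0; have [s us ls] := lb _ e0.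
rewrite -leeBlDr//; apply: esum_ge.
exists [set` s]; first by split => //; exact: finite_seq.
by rewrite -fsbig_seq// sumEFin -EFinB lee_fin.
Qed.

Lemma hsum_approx (R : realType) (T : choiceType) (f : T -> R) l e :
  hsum f l -> 0 < e -> exists2 s : seq T, uniq s & l - e < \sum_(i <- s) f i.
Proof.
move=> [f0 fl] e0.
have : ((l - e)%:E < \esum_(i in [set: T]) (f i)%:E)%E.
  by rewrite fl lte_fin ltrBlDr ltrDl.
move=> /ereal_sup_gt[_ [X [finX _]] <-]; rewrite fsbig_finite//= sumEFin lte_fin.
by move=> h; exists (finmap.enum_fset (fset_set X)); rewrite ?fset_uniq.
Qed.

Lemma hsum_bounded (R : realType) (T : choiceType) (f : T -> R) M :
  (forall i, 0 <= f i) ->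
  (forall s : seq T, uniq s -> \sum_(i <- s) f i <= M) ->
  exists2 l, hsum f l & l <= M.
Proof.
move=> f0 ub.
have le : (\esum_(i in [set: T]) (f i)%:E <= M%:E)%E.
  apply: ge_ereal_sup => _ [X [finX _] <-].
  by rewrite fsbig_finite//= sumEFin lee_fin ub// fset_uniq.
have fin : (\esum_(i in [set: T]) (f i)%:E \is a fin_num)%E.
  rewrite ge0_fin_numE; first by apply: le_lt_trans le _; rewrite ltry.
  by apply: esum_ge0 => i _; rewrite lee_fin.
exists (fine (\esum_(i in [set: T]) (f i)%:E)); first by split => //; rewrite fineK.
by rewrite -lee_fin fineK.
Qed.

Lemma hsum_le (R : realType) (T : choiceType) (f g : T -> R) l m :
  (forall i, f i <= g i) -> hsum f l -> hsum g m -> l <= m.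
Proof.
move=> fg [_ fl] [_ gm]; rewrite -lee_fin -fl -gm.
by apply: le_esum => i _; rewrite lee_fin.
Qed.

Lemma hsum_dom (R : realType) (T : choiceType) (f g : T -> R) m :
  (forall i, 0 <= f i <= g i) -> hsum g m -> exists2 l, hsum f l & l <= m.
Proof.
move=> fg hg; apply: hsum_bounded => [i|s us]; first by case/andP: (fg i).
apply: le_trans (hsum_seq_le hg us).
by apply: ler_sum => i _; case/andP: (fg i).
Qed.

Lemma hsumD (R : realType) (T : choiceType) (f g : T -> R) l m :
  hsum f l -> hsum g m -> hsum (fun i => f i + g i) (l + m).
Proof.
move=> [f0 fl] [g0 gm]; split=> [i|]; first exact: addr_ge0.
rewrite EFinD -fl -gm -esumD//.
- by move=> i _; rewrite lee_fin.
- by move=> i _; rewrite lee_fin.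
Qed.

(** The difference is summable because [g] dominates it; additivity and uniqueness of the sum then
    give its value. *)
Lemma hsumB (R : realType) (T : choiceType) (f g : T -> R) l m :
  (forall i, f i <= g i) -> hsum f l -> hsum g m ->
  hsum (fun i => g i - f i) (m - l).
Proof.
move=> fg hf hg.
have [|k hk _] := @hsum_dom _ _ (fun i => g i - f i) g m _ hg.
  by move=> i; rewrite subr_ge0 fg /= gerBl; case: hf => /(_ i).
suff -> : m - l = k by [].
have := hsumD hf hk; rewrite (_ : (fun i => _) = g); last first.
  by apply/funext => i; rewrite addrC subrK.
by move=> /hsum_uniq /(_ hg) <-; rewrite addrC addKr.
Qed.

Lemma hsumZ (R : realType) (T : choiceType) (f : T -> R) l c :
  0 <= c -> hsum f l -> hsum (fun i => c * f i) (c * l).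
Proof.
move=> c0 hf; have f0 := hf.1; apply: hsum_char => [i|s us|e e0].
- exact: mulr_ge0.
- by rewrite -mulr_sumr ler_wpM2l// (hsum_seq_le hf).
- move: c0; rewrite le_eqVlt => /predU1P[<-|c0].
    by exists [::] => //; rewrite big_nil mul0r sub0r oppr_le0 ltW.
  have [s us /ltW ls] := hsum_approx hf (divr_gt0 e0 c0).
  exists s => //; rewrite -mulr_sumr.
  apply: le_trans (ler_wpM2l (ltW c0) ls).
  by rewrite mulrBr mulrCA divff ?mulr1// gt_eqF.
Qed.

Lemma hsum_fin (R : realType) (T : choiceType) (f : T -> R) (s : seq T) :
  uniq s -> (forall i, 0 <= f i) -> (forall i, i \notin s -> f i = 0) ->
  hsum f (\sum_(i <- s) f i).
Proof.
move=> us f0 fs; apply: hsum_char => // [t ut|e e0]; last first.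
  by exists s => //; rewrite gerBl ltW.
rewrite (bigID (mem s)) /= [X in _ + X]big1 ?addr0; last by move=> i /fs.
rewrite -big_filter [leRHS](bigID (mem t)) /= -[X in _ <= X + _]big_filter.
rewrite (perm_big [seq i <- s | i \in t]); last first.
  apply: uniq_perm; rewrite ?filter_uniq// => i.
  by rewrite !mem_filter andbC.
by rewrite lerDl sumr_ge0.
Qed.

Lemma hsum0 (R : realType) (T : choiceType) : hsum (fun _ : T => 0 : R) 0.
Proof.
have := @hsum_fin R T (fun=> 0) [::] isT (fun=> lexx _) (fun _ _ => erefl).
by rewrite big_nil.
Qed.

Lemma hsum_sum (R : realType) (T : choiceType) (I : Type) (s : seq I)
    (f : I -> T -> R) (l : I -> R) :
  (forall j, hsum (f j) (l j)) ->
  hsum (fun i => \sum_(j <- s) f j i) (\sum_(j <- s) l j).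
Proof.
move=> hf; elim: s => [|j s IH].
  rewrite big_nil; apply: hsum_ext (hsum0 _ _) => i; by rewrite big_nil.
rewrite big_cons; apply: hsum_ext (hsumD (hf j) IH) => i.
by rewrite big_cons.
Qed.

Lemma hsum_pair (R : realType) (T1 T2 : choiceType) (f : T1 -> T2 -> R) g l :
  (forall i, hsum (f i) (g i)) ->
  hsum g l <-> hsum (fun p : T1 * T2 => f p.1 p.2) l.
Proof.
move=> hf; have f0 i j : 0 <= f i j by case: (hf i).
have -> : hsum (fun p : T1 * T2 => f p.1 p.2) l <->
          (\esum_(p in [set: T1 * T2]) (f p.1 p.2)%:E = l%:E)%E.
  by split=> [[]//|]; split.
have -> : hsum g l <-> (\esum_(i in [set: T1]) (g i)%:E = l%:E)%E.
  by split=> [[]//|]; split => // i; exact: hsum_ge0 (hf i).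
have -> : [set: T1 * T2] = [set: T1] `*`` (fun=> [set: T2]).
  by apply/seteqP; split.
rewrite -(@esum_esum _ _ _ _ _ (fun i j => (f i j)%:E)); last first.
  by move=> i j _ _; rewrite lee_fin.
under [X in _ <-> X = _]eq_esum do rewrite (hf _).2.
by [].
Qed.

(** Injectivity is asked on [P] alone, in view of the map (k, q) -> p^k q, which is injective only
    on the q prime to p. *)
Lemma hsum_reindex_in (R : realType) (T1 T2 : choiceType) (P : pred T1) (e : T1 -> T2)
    (f : T2 -> R) l :
  {in P &, injective e} -> (forall j, 0 <= f j) ->
  (forall j, f j != 0 -> exists2 i, P i & e i = j) ->
  hsum f l <-> hsum (fun i => (P i)%:R * f (e i)) l.
Proof.
move=> inje f0 sur; rewrite /hsum.
suff -> : (\esum_(i in [set: T2]) (f i)%:E =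
    \esum_(i in [set: T1]) ((P i)%:R * f (e i))%:E)%E.
  by split=> -[_ h]; split=> // i; rewrite mulr_ge0.
have -> : (\esum_(i in [set: T1]) ((P i)%:R * f (e i))%:E =
    \esum_(i in [set x | P x]) (f (e i))%:E)%E.
  rewrite [RHS]esum_mkcond; apply: eq_esum => i _.
  case: (boolP (P i)) => Pi; first by rewrite mem_set// mul1r.
  by rewrite memNset ?mul0r//; exact/negP.
rewrite -(@esum_image _ _ _ _ e (fun j => (f j)%:E)); last first.
  by move=> x y; rewrite !inE; exact: inje.
rewrite [RHS]esum_mkcond; apply: eq_esum => j _; case: ifPn => //.
rewrite notin_setE => nj; congr EFin; apply/eqP/negPn/negP => /sur[i Pi ij].
by apply: nj; exists i.
Qed.

Lemma hsum_reindex (R : realType) (T1 T2 : choiceType) (e : T1 -> T2)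
    (f : T2 -> R) l :
  injective e -> (forall j, 0 <= f j) -> (forall j, f j != 0 -> exists i, e i = j) ->
  hsum f l <-> hsum (f \o e) l.
Proof.
move=> inje f0 sur; rewrite (@hsum_reindex_in _ _ _ predT e)//; last first.
- by move=> j /sur[i ij]; exists i.
- by move=> x y _ _; exact: inje.
by rewrite (_ : (fun i => _) = f \o e)//; apply/funext => i; rewrite mul1r.
Qed.

(** Tonelli: both iterated sums equal the sum over pairs. Most closed forms below are one such
    exchange, with [f] the doubly indexed summand. *)
Lemma hsum_swap (R : realType) (T1 T2 : choiceType) (f : T1 -> T2 -> R) g1 g2 l :
  (forall i, hsum (f i) (g1 i)) -> (forall j, hsum (f^~ j) (g2 j)) ->
  hsum g1 l -> hsum g2 l.
Proof.
move=> h1 h2 /(hsum_pair _ h1) hp; apply/(hsum_pair _ h2).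
have inj : injective (fun p : T2 * T1 => (p.2, p.1)) by move=> [a b] [c d] [-> ->].
have f0 (p : T1 * T2) : 0 <= f p.1 p.2 by case: (h1 p.1).
have sur (p : T1 * T2) : f p.1 p.2 != 0 -> exists q : T2 * T1, (q.2, q.1) = p.
  by case: p => a b _; exists (b, a).
exact: ((hsum_reindex l inj f0 sur).1 hp).
Qed.

Lemma hsum_row (R : realType) (T1 T2 : choiceType) (f : T1 -> T2 -> R) l :
  hsum (fun p : T1 * T2 => f p.1 p.2) l -> exists g, forall i, hsum (f i) (g i).
Proof.
move=> hf; have f0 i j : 0 <= f i j := hf.1 (i, j).
suff H i : exists k, hsum (f i) k by exists (fun i => projT1 (cid (H i))) => i; case: cid.
have [|k hk _] := @hsum_bounded _ _ (f i) l (f0 i); last by exists k.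
move=> s us; have := hsum_seq_le hf (s := [seq (i, j) | j <- s]).
by rewrite big_map/= => -> //; rewrite map_inj_uniq// => a b [].
Qed.

Lemma hsum_prod (R : realType) (T1 T2 : choiceType) (f : T1 -> R) (g : T2 -> R) l m :
  hsum f l -> hsum g m -> hsum (fun p : T1 * T2 => f p.1 * g p.2) (l * m).
Proof.
move=> hf hg; have f0 := hf.1; apply/(hsum_pair (f := fun i j => f i * g j) (g := fun i => m * f i)).
  by move=> i; rewrite mulrC; exact: hsumZ.
by rewrite mulrC; apply: hsumZ => //; exact: hsum_ge0 hg.
Qed.

(** * Limits of sums, and series over the naturals *)

Lemma cvg_sum (R : realType) (I : Type) (f : I -> nat -> R) (l : I -> R) (s : seq I) :
  (forall i, f i @ \oo --> l i) ->
  (fun n => \sum_(i <- s) f i n) @ \oo --> \sum_(i <- s) l i.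
Proof.
move=> fl; elim: s => [|i s IH].
  by rewrite big_nil; under eq_fun do rewrite big_nil; exact: cvg_cst.
by rewrite big_cons; under eq_fun do rewrite big_cons; exact: cvgD.
Qed.

(* Tannery: f n and g - f n are both bounded below by their finite sums. *)
Lemma hsum_cvg (R : realType) (T : choiceType) (f : nat -> T -> R) (fl g : T -> R)
    (L : nat -> R) l m :
  hsum g m -> (forall n i, f n i <= g i) -> (forall i, f ^~ i @ \oo --> fl i) ->
  (forall n, hsum (f n) (L n)) -> hsum fl l -> L @ \oo --> l.
Proof.
move=> hg fg ffl hf hfl.
have flg i : fl i <= g i.
  have := @ler_cvg_to nat \oo _ R (f^~ i) (fun=> g i) _ _ (ffl i) (cvg_cst _).
  by apply; exact: nearW.
apply/cvgrPdist_le => e e0; have e3 : 0 < e / 3 by rewrite divr_gt0.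
have [s us /ltW hs] := hsum_approx hg e3.
have tail k K : (forall i, k i <= g i) -> hsum k K ->
    0 <= K - \sum_(i <- s) k i <= e / 3.
  move=> kg hk; rewrite subr_ge0 (hsum_seq_le hk)//=.
  have := hsum_seq_le (hsumB kg hk hg) us; rewrite sumrB; lra.
have := tail _ _ flg hfl => /andP[t1 t2].
have := @cvg_sum R T (fun i => f^~ i) fl s ffl => /cvgrPdist_le /(_ _ e3).
apply: filterS => n /=; rewrite ler_norml => /andP[h1 h2].
have /andP[t3 t4] := tail _ _ (fg n) (hf n).
rewrite ler_norml; lra.
Qed.

Lemma hsum_series0 (R : realType) (f : nat -> R) l :
  hsum f l -> (fun N => \sum_(0 <= i < N) f i) @ \oo --> l.
Proof.
move=> hf; have f0 := hf.1.
have := nneseries_esumT (fun n => (f0 n : (0 <= (f n)%:E)%E)).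
rewrite hf.2 => e.
have := @is_cvg_nneseries R (fun n => (f n)%:E) xpredT 0 (fun n _ _ => f0 n).
move=> /cvg_ex[x hx]; move: (e); rewrite (cvg_lim _ hx)// => ex; move: hx.
rewrite ex => /fine_cvgP[_]; apply: cvg_trans; apply: near_eq_cvg; near=> N.
by rewrite /= sumEFin.
Unshelve. all: by end_near.
Qed.

Lemma hsum_series (R : realType) (f : nat -> R) l :
  hsum f l -> f 0%N = 0 -> (fun N => \sum_(1 <= i < N) f i) @ \oo --> l.
Proof.
move=> hf f00; have := hsum_series0 hf.
rewrite (_ : (fun N => _) = (fun N => \sum_(1 <= i < N) f i))//.
apply/funext => -[|N]; first by rewrite !big_nil.
by rewrite big_ltn// f00 add0r.
Qed.

(** Every finite set of naturals lies in an initial segment, so bounded partial sums bound all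
    finite sums. *)
Lemma hsum_of_series_bounded (R : realType) (f : nat -> R) M :
  (forall i, 0 <= f i) -> (forall N, \sum_(0 <= i < N) f i <= M) ->
  exists2 l, hsum f l & l <= M.
Proof.
move=> f0 fM; apply: hsum_bounded => // s us.
pose N := (\max_(i <- s) i).+1.
apply: le_trans (fM N).
have hfin : hsum (fun i => if (i < N)%N then f i else 0)
    (\sum_(i <- index_iota 0 N) if (i < N)%N then f i else 0).
  apply: hsum_fin => [|i|i]; [exact: iota_uniq|by case: ifP|].
  by rewrite mem_index_iota /= => /negbTE ->.
have := hsum_seq_le hfin us.
rewrite (eq_big_nat _ _ (F2 := f)) => [|i /= ->//].
rewrite (eq_big_seq f)// => i ims; rewrite ltnS.
by rewrite ifT//; exact: (leq_bigmax_seq (F := fun i => i)).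
Qed.

Lemma hsum_of_series_cvg (R : realType) (f : nat -> R) l :
  (forall i, 0 <= f i) -> (forall N, \sum_(0 <= i < N) f i <= l) ->
  (fun N => \sum_(0 <= i < N) f i) @ \oo --> l -> hsum f l.
Proof.
move=> f0 fl cf; have [m hm _] := hsum_of_series_bounded f0 fl.
by rewrite (cvg_unique _ cf (hsum_series0 hm)).
Qed.

Lemma hsum_multiples (R : realType) (F : nat -> R) (q : nat) l :
  (0 < q)%N -> (forall i, 0 <= F i) ->
  hsum (fun m => F (q * m)%N) l <-> hsum (fun i => (q %| i)%:R * F i) l.
Proof.
move=> q0 F0.
have inj : injective (muln q).
  by move=> a b /eqP; rewrite eqn_pmul2l// => /eqP.
have f0 i : 0 <= (q %| i)%:R * F i by rewrite mulr_ge0.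
have sur i : (q %| i)%:R * F i != 0 -> exists j, (q * j)%N = i.
  case: (boolP (q %| i)%N) => [/dvdnP[k ->] _|_]; last by rewrite mul0r eqxx.
  by exists k; rewrite mulnC.
rewrite (hsum_reindex l inj f0 sur).
suff -> : (fun i => (q %| i)%:R * F i) \o muln q = fun m => F (q * m)%N by [].
by apply/funext => m /=; rewrite dvdn_mulr// mul1r.
Qed.

(** * Majorants *)

(** The estimates only involve exponents that are multiples of 1/4. In terms of k^(1/4) they become
    integer powers, within reach of [field]. *)
Definition root4 (R : realType) (k : nat) : R := Num.sqrt (Num.sqrt k%:R).

Lemma root4_ge0 (R : realType) k : 0 <= root4 R k.
Proof. exact: sqrtr_ge0. Qed.

Lemma root4X (R : realType) k : root4 R k ^+ 4 = k%:R.
Proof.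
rewrite (exprM _ 2 2) !sqr_sqrtr ?ler0n//; exact: sqrtr_ge0.
Qed.

Lemma root4_le (R : realType) : {homo root4 R : m n / (m <= n)%N >-> m <= n}.
Proof. by move=> m n mn; rewrite /root4 !ler_sqrt ?sqrtr_ge0 ?ler0n ?ler_nat. Qed.

Lemma root4_ge1 (R : realType) k : (0 < k)%N -> 1 <= root4 R k.
Proof. by move=> k0; rewrite (_ : 1 = root4 R 1) ?root4_le// /root4 !sqrtr1. Qed.

(** The gcd g is at most m and at most n, and g = g^(3/4) g^(1/4). The split is lopsided on purpose:
    dividing by m^2 leaves the summable m^(-5/4), while the dependence on n is only n^(1/4). *)
Lemma gcd_le_root4 (R : realType) m n : (0 < m)%N -> (0 < n)%N ->
  (gcdn m n)%:R <= root4 R m ^+ 3 * root4 R n.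
Proof.
move=> m0 n0; rewrite -root4X exprSr.
have gm : root4 R (gcdn m n) <= root4 R m by rewrite root4_le// dvdn_leq// dvdn_gcdl.
have gn : root4 R (gcdn m n) <= root4 R n by rewrite root4_le// dvdn_leq// dvdn_gcdr.
by rewrite ler_pM ?exprn_ge0 ?root4_ge0// lerXn2r ?nnegrE ?root4_ge0.
Qed.

(* [1 / k ^ (5/4)], and [0] at [k = 0] since inverting [0] gives [0]. *)
Definition pow54 (R : realType) (k : nat) : R := (k%:R * root4 R k)^-1.

Lemma pow54_ge0 (R : realType) k : 0 <= pow54 R k.
Proof. by rewrite invr_ge0 mulr_ge0 ?root4_ge0. Qed.

(** A discrete form of the primitive -4 t^(-1/4) of t^(-5/4). With u^4 = k + 1 and v^4 = k,
    factoring u^4 - v^4 = 1 gives 4 u^3 (u - v) >= 1, hence 4/v - 4/u >= 1/(u^4 v) >= 1/u^5. *)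
Lemma pow54_step (R : realType) k : (0 < k)%N ->
  pow54 R k.+1 <= 4 / root4 R k - 4 / root4 R k.+1.
Proof.
move=> k0; rewrite /pow54.
have := root4X R k.+1.
have : root4 R k.+1 ^+ 4 = root4 R k ^+ 4 + 1 by rewrite !root4X natr1.
have := root4_ge1 R k0; have := root4_le R (leqnSn k).
move: (root4 R k) (root4 R k.+1) => v u vu v1 e e'.
have v0 : 0 < v by lra.
have u0 : 0 < u by lra.
have d1 : (u - v) * ((u + v) * (u ^+ 2 + v ^+ 2)) = 1.
  by move: e; rewrite !exprS expr0; lra.
have le : (u + v) * (u ^+ 2 + v ^+ 2) <= 4 * u ^+ 3.
  have : v ^+ 2 <= u ^+ 2 by rewrite lerXn2r ?nnegrE; lra.
  have : 0 <= v ^+ 2 by rewrite sqr_ge0.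
  by rewrite (exprS u 2); nra.
have h : 1 <= (u - v) * (4 * u ^+ 3) by rewrite -[leLHS]d1 ler_wpM2l// subr_ge0.
rewrite -e' -subr_ge0.
rewrite (_ : _ - _ = (u * ((u - v) * (4 * u ^+ 3)) - v) / (u ^+ 5 * v)); last first.
  by field; rewrite !gt_eqF.
apply: divr_ge0; last by rewrite mulr_ge0 ?exprn_ge0 ?ltW.
rewrite subr_ge0; apply: le_trans vu _.
by rewrite ler_peMr// ltW.
Qed.

Lemma hsum_pow54 (R : realType) : exists Z, hsum (pow54 R) Z.
Proof.
suff [l hl _] : exists2 l, hsum (pow54 R) l & l <= 5 by exists l.
apply: hsum_of_series_bounded => [|N]; first exact: pow54_ge0.
(* The constant 5 is the term 1 at k = 1 plus the total 4 of the telescoping bound; at [n = 0] this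
   is an equality. *)
suff H n : \sum_(0 <= i < n.+2) pow54 R i <= 5 - 4 / root4 R n.+1.
  apply: le_trans (_ : \sum_(0 <= i < N.+2) pow54 R i <= _).
    by rewrite !big_nat_recr//= -addrA lerDl addr_ge0 ?pow54_ge0.
  by apply: le_trans (H N) _; rewrite gerBl divr_ge0// root4_ge0.
elim: n => [|n IH].
  rewrite !big_nat_recr//= big_nil /pow54 mul0r invr0 /root4 !sqrtr1.
  lra.
rewrite big_nat_recr//=; have := pow54_step R (ltn0Sn n); lra.
Qed.

Lemma pow54E (R : realType) k : pow54 R k = (root4 R k ^+ 5)^-1.
Proof. by rewrite /pow54 -root4X -exprSr. Qed.

Lemma natr_root4 (R : realType) k : k%:R = root4 R k ^+ 4.
Proof. by rewrite root4X. Qed.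

Lemma hsum_inv_pow (R : realType) (s : nat) : (1 < s)%N ->
  exists z, hsum (fun k => (k%:R ^+ s)^-1 : R) z.
Proof.
move=> s1; have [Z hZ] := hsum_pow54 R.
have [|z hz _] := hsum_dom _ hZ (f := fun k => (k%:R ^+ s)^-1 : R); last by exists z.
move=> [|k]; first by rewrite /pow54 expr0n gtn_eqF ?(ltn_trans _ s1)//= invr0 mul0r invr0 lexx.
rewrite invr_ge0 exprn_ge0//= pow54E natr_root4 -exprM.
have r1 := root4_ge1 R (ltn0Sn k).
rewrite lef_pV2 ?posrE ?exprn_gt0 ?(lt_le_trans ltr01)//.
by apply: ler_weXn2l => //; lia.
Qed.

Lemma gcd_coef_term_le (R : realType) d m : (0 < d)%N ->
  (gcdn m d)%:R / m%:R ^+ 2 <= root4 R d * pow54 R m.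
Proof.
case: m => [|m] d0; first by rewrite mulr0n expr0n/= invr0 mulr0 mulr_ge0 ?root4_ge0// pow54_ge0.
rewrite pow54E [in leLHS](natr_root4 R m.+1) -exprM.
have r1 := root4_ge1 R (ltn0Sn m).
rewrite ler_pdivrMr ?exprn_gt0 ?(lt_le_trans ltr01)//.
apply: le_trans (gcd_le_root4 R (ltn0Sn m) d0) _.
rewrite mulrC -mulrA ler_wpM2l ?root4_ge0// le_eqVlt; apply/orP; left; apply/eqP.
by field; rewrite gt_eqF// (lt_le_trans ltr01).
Qed.

Lemma hsum_gcd_coef (R : realType) d : (0 < d)%N ->
  hsum (fun m => (gcdn m d)%:R / m%:R ^+ 2 : R) (gcd_coef R d).
Proof.
move=> d0; have [Z hZ] := hsum_pow54 R.
have [|c hc _] := hsum_dom _ (hsumZ (root4_ge0 R d) hZ)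
    (f := fun m => (gcdn m d)%:R / m%:R ^+ 2 : R).
  by move=> m; rewrite gcd_coef_term_le// divr_ge0 ?exprn_ge0.
have := hsum_series hc; rewrite expr0n/= invr0 mulr0 => /(_ erefl) /cvg_lim.
by move=> h; rewrite /gcd_coef h.
Qed.

Lemma gcd_coef_le (R : realType) Z d : hsum (pow54 R) Z -> (0 < d)%N ->
  gcd_coef R d <= Z * root4 R d.
Proof.
move=> hZ d0.
rewrite mulrC; apply: hsum_le (hsum_gcd_coef R d0) (hsumZ (root4_ge0 R d) hZ) => m.
exact: gcd_coef_term_le.
Qed.

Lemma gcd_coef_ge1 (R : realType) d : (0 < d)%N -> 1 <= gcd_coef R d.
Proof.
move=> d0; have := hsum_seq_le (s := [:: 1%N]) (hsum_gcd_coef R d0) isT.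
by rewrite big_seq1 gcd1n expr1n divr1.
Qed.

(** * The spectral form of the three sums *)

(** The balanced split gcd(m, n) <= sqrt(m n), suited to the double sums, where both variables need
    the same decay. *)
Lemma gcd_le_root4_sym (R : realType) m n : (0 < m)%N -> (0 < n)%N ->
  (gcdn m n)%:R <= root4 R m ^+ 2 * root4 R n ^+ 2.
Proof.
move=> m0 n0; rewrite -root4X (exprD _ 2 2).
have gm : root4 R (gcdn m n) <= root4 R m by rewrite root4_le// dvdn_leq// dvdn_gcdl.
have gn : root4 R (gcdn m n) <= root4 R n by rewrite root4_le// dvdn_leq// dvdn_gcdr.
by rewrite ler_pM ?exprn_ge0 ?root4_ge0// lerXn2r ?nnegrE ?root4_ge0.
Qed.

Lemma gcd_coef_ge0 (R : realType) d : (0 < d)%N -> 0 <= gcd_coef R d.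
Proof. by move=> /(gcd_coef_ge1 R); apply: le_trans. Qed.

Lemma gcd_coef_div_ge0 (R : realType) d s : 0 <= gcd_coef R d / d%:R ^+ s.+1.
Proof.
case: d => [|d]; first by rewrite expr0n/= invr0 mulr0.
by rewrite divr_ge0 ?exprn_ge0// gcd_coef_ge0.
Qed.

(** Since c_d = O(d^(1/4)), the quotient is O(d^(-7/4)). It is written as d^(-5/4) d^(-1/2) so that
    the spare d^(-1/2) absorbs one half of gcd(a, b) <= sqrt(a b) in [hsum_gcd_form]. *)
Lemma gcd_coef_div_le (R : realType) Z d : hsum (pow54 R) Z ->
  gcd_coef R d / d%:R ^+ 2 <= Z * pow54 R d / root4 R d ^+ 2.
Proof.
move=> hZ; case: d => [|d].
  by rewrite expr0n/= invr0 mulr0 /pow54 mul0r invr0 mulr0 mul0r.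
have r1 := root4_ge1 R (ltn0Sn d).
have r0 : 0 < root4 R d.+1 by lra.
rewrite pow54E (natr_root4 R d.+1) -exprM ler_pdivrMr ?exprn_gt0//.
apply: le_trans (gcd_coef_le hZ (ltn0Sn d)) _.
rewrite le_eqVlt; apply/orP; left; apply/eqP.
by field; rewrite gt_eqF.
Qed.

Lemma hsum_gcd_coef_sqr (R : realType) :
  exists S, hsum (fun d => gcd_coef R d ^+ 2 / d%:R ^+ 2) S.
Proof.
have [Z hZ] := hsum_pow54 R; have Z0 := hsum_ge0 hZ.
have [|S hS _] := hsum_dom _ (hsumZ (sqr_ge0 Z) hZ)
  (f := fun d => gcd_coef R d ^+ 2 / d%:R ^+ 2); last by exists S.
move=> [|d]; first by rewrite expr0n/= invr0 mulr0 lexx mulr_ge0 ?sqr_ge0// pow54_ge0.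
rewrite divr_ge0 ?sqr_ge0//=.
have r1 := root4_ge1 R (ltn0Sn d).
have r0 : 0 < root4 R d.+1 by lra.
rewrite pow54E (natr_root4 R d.+1) -exprM ler_pdivrMr ?exprn_gt0//.
apply: le_trans (_ : (Z * root4 R d.+1) ^+ 2 <= _).
  by rewrite lerXn2r ?nnegrE ?gcd_coef_ge0 ?gcd_coef_le// mulr_ge0// ltW.
rewrite exprMn -[leRHS]mulrA ler_wpM2l ?sqr_ge0//.
rewrite [leRHS](_ : _ = root4 R d.+1 ^+ 3); last by field; rewrite gt_eqF.
exact: ler_weXn2l.
Qed.

Lemma hsum_gcd_sqr (R : realType) :
  exists V, hsum (fun p : nat * nat =>
    (p.1%:R ^+ 2)^-1 * (p.2%:R ^+ 2)^-1 * (gcdn p.1 p.2)%:R : R) V.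
Proof.
have [Z hZ] := hsum_pow54 R; have Z0 := hsum_ge0 hZ.
have [|V hV _] := hsum_dom _ (hsum_prod hZ hZ)
  (f := fun p : nat * nat => (p.1%:R ^+ 2)^-1 * (p.2%:R ^+ 2)^-1 * (gcdn p.1 p.2)%:R : R); last by exists V.
move=> [a b] /=; rewrite !mulr_ge0 ?invr_ge0 ?exprn_ge0//=.
case: a => [|a]; first by rewrite expr0n/= invr0 !mul0r mulr_ge0 ?pow54_ge0.
case: b => [|b]; first by rewrite expr0n/= invr0 mulr0 mul0r mulr_ge0 ?pow54_ge0.
rewrite !pow54E (natr_root4 R a.+1) (natr_root4 R b.+1).
have := gcd_le_root4_sym R (ltn0Sn a) (ltn0Sn b).
have := root4_ge1 R (ltn0Sn a); have := root4_ge1 R (ltn0Sn b).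
move: (root4 _ _) (root4 _ _) => u v v1 u1 g.
have u0 : 0 < u by lra.
have v0 : 0 < v by lra.
rewrite mulrC -!invfM ler_pdivrMr ?mulr_gt0 ?exprn_gt0//.
apply: le_trans g _.
rewrite [leRHS](_ : _ = u ^+ 3 * v ^+ 3); last by field; rewrite !gt_eqF.
by apply: ler_pM; rewrite ?exprn_ge0 ?ler_weXn2l// ltW.
Qed.

Lemma hsum_gcd_form (R : realType) :
  exists G, hsum (fun p : nat * nat => (gcd_coef R p.1 / p.1%:R ^+ 2) *
    (gcd_coef R p.2 / p.2%:R ^+ 2) * (gcdn p.1 p.2)%:R) G.
Proof.
have [Z hZ] := hsum_pow54 R; have Z0 := hsum_ge0 hZ.
have [|G hG _] := hsum_dom _ (hsumZ (sqr_ge0 Z) (hsum_prod hZ hZ))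
  (f := fun p : nat * nat => (gcd_coef R p.1 / p.1%:R ^+ 2) *
    (gcd_coef R p.2 / p.2%:R ^+ 2) * (gcdn p.1 p.2)%:R); last by exists G.
move=> [a b] /=; rewrite [0 <= _]mulr_ge0//=; last first.
  by apply: mulr_ge0; exact: gcd_coef_div_ge0.
case: a => [|a]; first by rewrite expr0n/= invr0 mulr0 !mul0r !mulr_ge0 ?pow54_ge0.
case: b => [|b]; first by rewrite expr0n/= invr0 !mulr0 mul0r !mulr_ge0 ?pow54_ge0.
apply: le_trans (_ : (Z * pow54 R a.+1 / root4 R a.+1 ^+ 2) *
  (Z * pow54 R b.+1 / root4 R b.+1 ^+ 2) * (root4 R a.+1 ^+ 2 * root4 R b.+1 ^+ 2) <= _).
  apply: ler_pM; rewrite ?gcd_le_root4_sym//.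
    by apply: mulr_ge0; exact: gcd_coef_div_ge0.
  by apply: ler_pM; rewrite ?gcd_coef_div_ge0 ?gcd_coef_div_le.
have := root4_ge1 R (ltn0Sn a); have := root4_ge1 R (ltn0Sn b).
move: (root4 _ a.+1) (root4 _ b.+1) => u v v1 u1.
rewrite le_eqVlt; apply/orP; left; apply/eqP.
by field; apply/andP; split; apply: lt0r_neq0; lra.
Qed.

(** Gauss's identity with the divisibility condition turned into a factor, which makes it ready for
    exchanges of sums. *)
Lemma hsum_totient (R : realType) n : (0 < n)%N ->
  hsum (fun e => (e %| n)%:R * (totient e)%:R : R) n%:R.
Proof.
move=> n0; rewrite -[in X in hsum _ X](sum_totient_dvd n) natr_sum.
rewrite (_ : \sum_(d < n.+1 | _) _ =
  \sum_(e <- index_iota 0 n.+1) (e %| n)%:R * (totient e)%:R :> R); last first.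
  rewrite big_mkord big_mkcond/=; apply: eq_bigr => i _.
  by case: (_ %| _)%N; rewrite ?mul1r ?mul0r.
apply: hsum_fin => [|i|i]; rewrite ?iota_uniq ?mulr_ge0//.
rewrite mem_index_iota ltnS /= -ltnNge => ni.
by rewrite gtnNdvd// mul0r.
Qed.

(** Gauss's identity diagonalises the gcd kernel: each e contributes phi(e) times the square of the
    sum of x over the multiples of e. The condition [x 0%N = 0] disposes of the pair (0, 0), whose
    common divisors are all the naturals. *)
Lemma hsum_gram (R : realType) (x X : nat -> R) l :
  (forall a, 0 <= x a) -> x 0%N = 0 ->
  (forall e, (0 < e)%N -> hsum (fun a => (e %| a)%:R * x a) (X e)) ->
  hsum (fun p : nat * nat => x p.1 * x p.2 * (gcdn p.1 p.2)%:R) l ->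
  hsum (fun e => (totient e)%:R * X e ^+ 2) l.
Proof.
move=> x0 x00 hX.
pose f (p : nat * nat) e :=
  (totient e)%:R * (((e %| p.1)%:R * x p.1) * ((e %| p.2)%:R * x p.2)).
apply: (hsum_swap (f := f)) => [[a b]|e]; rewrite /f /=.
  case: a => [|a]; first by rewrite x00 !mul0r; apply: hsum_ext (hsum0 _ _) => e; ring.
  apply: hsum_ext (hsumZ _ (hsum_totient R _)).
  - by move=> e; rewrite dvdn_gcd; case: (_ %| _)%N; case: (_ %| _)%N => /=; ring.
  - by rewrite mulr_ge0.
  - by rewrite gcdn_gt0.
case: e => [|e]; first by rewrite mul0r; apply: hsum_ext (hsum0 _ _) => p; rewrite mul0r.
by apply: hsumZ => //; rewrite expr2; exact: hsum_prod (hX _ _) (hX _ _).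
Qed.

Lemma hsum_inv_pow_multiples (R : realType) s z q : (0 < q)%N -> (0 < s)%N ->
  hsum (fun k => (k%:R ^+ s)^-1 : R) z ->
  hsum (fun k => (q %| k)%:R * (k%:R ^+ s)^-1 : R) (z / q%:R ^+ s).
Proof.
move=> q0 s0 hz; apply/hsum_multiples => //.
rewrite mulrC; apply: hsum_ext (hsumZ _ hz); rewrite ?invr_ge0 ?exprn_ge0// => i /=.
by rewrite natrM exprMn invfM.
Qed.

(** After expanding gcd(m, d), the m divisible by e contribute zeta(2) / e^2 for each divisor e of
    d. *)
Lemma hsum_gcd_coef_totient (R : realType) z2 d : (0 < d)%N ->
  hsum (fun k => (k%:R ^+ 2)^-1 : R) z2 ->
  hsum (fun e => (e %| d)%:R * (z2 * (totient e)%:R / e%:R ^+ 2)) (gcd_coef R d).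
Proof.
move=> d0 hz; have := hsum_gcd_coef R d0.
pose f (m e : nat) : R := (e %| d)%:R * (totient e)%:R * ((e %| m)%:R * (m%:R ^+ 2)^-1).
apply: (hsum_swap (f := f)) => [m|e]; rewrite /f.
  rewrite mulrC; apply: hsum_ext (hsumZ _ (hsum_totient R _)).
  - by move=> e; rewrite dvdn_gcd; case: (_ %| _)%N; case: (_ %| _)%N => /=; ring.
  - by rewrite invr_ge0 exprn_ge0.
  - by rewrite gcdn_gt0 d0 orbT.
case: e => [|e].
  by rewrite !(mulr0, mul0r); apply: hsum_ext (hsum0 _ _) => e; rewrite ?(mulr0, mul0r).
rewrite (_ : _ * (_ / _) = (e.+1 %| d)%:R * (totient e.+1)%:R * (z2 / e.+1%:R ^+ 2)); last by ring.
by apply: hsumZ; rewrite ?mulr_ge0//; exact: hsum_inv_pow_multiples.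
Qed.

Definition weight (R : realType) (q : nat) : R := (totient q)%:R / q%:R ^+ 4.

Lemma weight_ge0 (R : realType) q : 0 <= weight R q.
Proof. by rewrite divr_ge0// exprn_ge0. Qed.

Lemma weight0 (R : realType) : weight R 0 = 0.
Proof. by rewrite /weight mul0r. Qed.

Lemma spectral_form (R : realType) (z2 z3 z4 V S G : R) :
  hsum (fun k => (k%:R ^+ 2)^-1 : R) z2 ->
  hsum (fun k => (k%:R ^+ 3)^-1 : R) z3 ->
  hsum (fun k => (k%:R ^+ 4)^-1 : R) z4 ->
  hsum (fun p : nat * nat =>
    (p.1%:R ^+ 2)^-1 * (p.2%:R ^+ 2)^-1 * (gcdn p.1 p.2)%:R : R) V ->
  hsum (fun d => gcd_coef R d ^+ 2 / d%:R ^+ 2) S ->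
  hsum (fun p : nat * nat => (gcd_coef R p.1 / p.1%:R ^+ 2) *
    (gcd_coef R p.2 / p.2%:R ^+ 2) * (gcdn p.1 p.2)%:R) G ->
  exists A B C (h : nat -> R),
    [/\ hsum (weight R) A,
        forall q, (0 < q)%N -> hsum (fun e => weight R e * (gcdn e q)%:R ^+ 2) (h q),
        hsum (fun q => weight R q * h q) B /\
        hsum (fun q => weight R q * h q ^+ 2) C,
        [/\ V = z2 ^+ 2 * A, S = z2 ^+ 3 * B & G = z2 ^+ 4 * C] &
        A * z4 = z3].
Proof.
move=> hz2 hz3 hz4 hV hS hG.
have z21 : 1 <= z2.
  have := hsum_seq_le (s := [:: 1%N]) hz2 isT.
  by rewrite big_seq1 expr1n invr1.
have z20 : 0 < z2 by lra.
have hc := hsum_gcd_coef_totient _ hz2.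
have hA : hsum (weight R) (V / z2 ^+ 2).
  have := hsum_gram _ _ (fun e e0 => hsum_inv_pow_multiples e0 _ hz2) hV.
  move=> /(_ _ _ _)/(hsumZ (c := (z2 ^+ 2)^-1)).
  rewrite mulrC => h; apply: hsum_ext (h _ _ _ _) => //.
  - move=> [|e]; first by rewrite weight0 mul0r mulr0.
    rewrite /weight; have := pnatr_eq0 R e.+1; move: (e.+1%:R : R) => y y0; field.
    by rewrite y0 (gt_eqF z20).
  - by rewrite invr_ge0 exprn_ge0// ltW.
  - by rewrite expr0n/= invr0.
pose x i := gcd_coef R i / i%:R ^+ 2.
have x0 i : 0 <= x i by exact: gcd_coef_div_ge0.
have [X hX] : exists X, hsum x X.
  have [|X hX _] := hsum_dom _ hS (f := x); last by exists X.
  move=> [|i]; first by rewrite x0 /x expr0n/= invr0 !mulr0 lexx.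
  rewrite x0/= /x ler_wpM2r ?invr_ge0 ?exprn_ge0//.
  by rewrite expr2 ler_peMr ?gcd_coef_ge0 ?gcd_coef_ge1.
have /choice[a ha] q : exists aq, hsum (fun i => (q %| i)%:R * x i) aq.
  have [|aq haq _] := hsum_dom _ hX (f := fun i => (q %| i)%:R * x i); last by exists aq.
  by move=> i; case: (_ %| _)%N; rewrite ?mul0r ?mul1r lexx x0.
(* Here [a q] sums c_i / i^2 over the multiples i of q. Expanding c_i and summing over the common
   multiples of q and e produces zeta(2)^2 phi(e) / (e lcm(q, e))^2; the scaling by q^2 turns q e /
   lcm(q, e) into gcd(e, q). *)
pose h q := a q * q%:R ^+ 2 / z2 ^+ 2.
have ah q : (0 < q)%N -> a q = z2 ^+ 2 / q%:R ^+ 2 * h q.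
  by move=> q0; rewrite /h; field; rewrite ?pnatr_eq0 -?lt0n ?q0 ?(gt_eqF z20).
have hh q : (0 < q)%N -> hsum (fun e => weight R e * (gcdn e q)%:R ^+ 2) (h q).
  move=> q0; pose f i e : R := ((q %| i)%:R * (i%:R ^+ 2)^-1) *
    ((e %| i)%:R * (z2 * (totient e)%:R / e%:R ^+ 2)).
  pose g e := z2 * (totient e)%:R / e%:R ^+ 2 * (z2 / (lcmn q e)%:R ^+ 2).
  have : hsum g (a q).
    apply: (hsum_swap (f := f)) (ha q) => [[|i]|e]; rewrite /f.
    - rewrite /x expr0n/= invr0 !mulr0; apply: hsum_ext (hsum0 _ _) => i.
      by rewrite mul0r.
    - rewrite /x (mulrC (gcd_coef _ _)) mulrA; apply: hsumZ; last exact: hc.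
      by rewrite mulr_ge0 ?invr_ge0 ?exprn_ge0.
    case: e => [|e].
      by rewrite /g !(mulr0, mul0r); apply: hsum_ext (hsum0 _ _) => e; rewrite !(mulr0, mul0r).
    have l0 : (0 < lcmn q e.+1)%N by rewrite lcmn_gt0 q0.
    apply: hsum_ext (hsumZ _ (hsum_inv_pow_multiples l0 _ hz2)) => //.
      by move=> i; rewrite dvdn_lcm; case: (q %| i)%N; case: (_ %| i)%N => /=; ring.
    by rewrite divr_ge0 ?exprn_ge0// mulr_ge0// ltW.
  move=> /(hsumZ (c := q%:R ^+ 2 / z2 ^+ 2)) hg.
  rewrite /h -mulrA mulrC; apply: hsum_ext (hg _).
    move=> [|e]; first by rewrite weight0 /g !(mulr0, mul0r).
    have -> : (gcdn e.+1 q)%:R = q%:R * e.+1%:R / (lcmn q e.+1)%:R :> R.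
      rewrite -natrM -muln_lcm_gcd gcdnC natrM mulrAC mulfV ?mul1r// pnatr_eq0 -lt0n.
      by rewrite lcmn_gt0 q0.
    rewrite /g /weight; have := pnatr_eq0 R (lcmn q e.+1); move: (lcmn q e.+1)%:R => m.
    rewrite eqn0Ngt lcmn_gt0 q0 /= => m0.
    have := pnatr_eq0 R e.+1; move: (e.+1%:R : R) => y y0; field.
    by rewrite (gt_eqF z20) y0 m0 ?pnatr_eq0 -?lt0n ?q0.
  by rewrite divr_ge0 ?exprn_ge0// ltW.
exists (V / z2 ^+ 2), (S / z2 ^+ 3), (G / z2 ^+ 4), h; split => //.
- split.
    (* Only one of the two factors c_i in S is expanded; summing over i first then leaves [a e]. *)
    pose f i e : R := x i * ((e %| i)%:R * (z2 * (totient e)%:R / e%:R ^+ 2)).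
    pose g e := z2 * (totient e)%:R / e%:R ^+ 2 * a e.
    have : hsum g S.
      apply: (hsum_swap (f := f)) hS => [[|i]|e]; rewrite /f.
      + rewrite expr0n/= invr0 mulr0; apply: hsum_ext (hsum0 _ _) => i.
        by rewrite /x expr0n/= invr0 mulr0 mul0r.
      + rewrite (_ : _ / _ = x i.+1 * gcd_coef R i.+1); first exact: hsumZ (hc _ _).
        by rewrite /x; ring.
      + apply: hsum_ext (hsumZ _ (ha e)); first by move=> i /=; ring.
        by rewrite divr_ge0 ?exprn_ge0// mulr_ge0// ltW.
    move=> /(hsumZ (c := (z2 ^+ 3)^-1)) hg.
    rewrite mulrC; apply: hsum_ext (hg _).
      move=> [|e]; first by rewrite weight0 /g !(mulr0, mul0r).
      rewrite /g ah// /weight; have := pnatr_eq0 R e.+1; move: (e.+1%:R : R) => y y0; field.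
      by rewrite y0 (gt_eqF z20).
    by rewrite invr_ge0 exprn_ge0// ltW.
  have := hsum_gram x0 _ (fun e _ => ha e) hG.
  move=> /(_ _)/(hsumZ (c := (z2 ^+ 4)^-1)).
  rewrite mulrC => hg; apply: hsum_ext (hg _ _).
  + move=> [|e]; first by rewrite weight0 !(mulr0, mul0r).
    rewrite ah// /weight; have := pnatr_eq0 R e.+1; move: (e.+1%:R : R) => y y0; field.
    by rewrite y0 (gt_eqF z20).
  + by rewrite invr_ge0 exprn_ge0// ltW.
  + by rewrite /x expr0n/= invr0 mulr0.
- by split; field; rewrite gt_eqF.
(* The Dirichlet series of phi at 4 is zeta(3) / zeta(4): divide Gauss's identity by n^4 and sum
   over n. *)
- pose f n e : R := (totient e)%:R * ((e %| n)%:R * (n%:R ^+ 4)^-1).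
  suff : hsum (fun e => weight R e * z4) z3.
    have := hsumZ (hsum_ge0 hz4) hA; under eq_fun do rewrite mulrC.
    by move=> /hsum_uniq u /u <-; rewrite mulrC.
  apply: (hsum_swap (f := f)) hz3 => [[|n]|[|e]]; rewrite /f.
  + rewrite !expr0n/= invr0; apply: hsum_ext (hsum0 _ _) => i; by rewrite !mulr0.
  + rewrite (_ : (_ ^+ 3)^-1 = (n.+1%:R ^+ 4)^-1 * n.+1%:R); last first.
      have := pnatr_eq0 R n.+1; move: (n.+1%:R : R) => y y0; field.
      by rewrite y0.
    apply: hsum_ext (hsumZ _ (hsum_totient R _)) => //.
    by move=> e /=; ring.
  + by rewrite weight0 mul0r; apply: hsum_ext (hsum0 _ _) => i; rewrite mul0r.
  + rewrite (_ : _ * z4 = (totient e.+1)%:R * (z4 / e.+1%:R ^+ 4)).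
      by apply: hsumZ => //; exact: hsum_inv_pow_multiples.
    by rewrite /weight; ring.
Qed.

(** * The relation between zeta(2) and zeta(4) *)

(* Zagier's kernel: by [zagierE] the double sum of [1 / (m ^ 2 * n ^ 2)] telescopes to the diagonal. *)
Definition zagier (R : realType) (m n : nat) : R :=
  (m%:R * n%:R ^+ 3)^-1 + (2 * m%:R ^+ 2 * n%:R ^+ 2)^-1 + (m%:R ^+ 3 * n%:R)^-1.

Lemma zagierC (R : realType) m n : zagier R m n = zagier R n m.
Proof. by rewrite /zagier addrAC [RHS]addrC addrA; do 2?congr (_ + _); congr (_^-1); ring. Qed.

Lemma zagierE (R : realType) m n : (0 < m)%N -> (0 < n)%N ->
  zagier R m n - zagier R (m + n) n - zagier R m (m + n) =
  (m%:R ^+ 2)^-1 * (n%:R ^+ 2)^-1.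
Proof.
move=> m0 n0; rewrite /zagier natrD.
have x0 : 0 < m%:R :> R by rewrite ltr0n.
have y0 : 0 < n%:R :> R by rewrite ltr0n.
move: m%:R n%:R x0 y0 => x y x0 y0; field.
by rewrite !gt_eqF// addr_gt0.
Qed.

(** In the shifted terms put k = i + j + 1, the zero-based form of m + n. They then run over pairs k
    > j; those with k < N cancel the off-diagonal part, by symmetry, and those with k >= N form the
    boundary sum. *)
Lemma zagier_sum (R : realType) (F : nat -> nat -> R) N :
  (forall i j, F i j = F j i) ->
  \sum_(j < N) \sum_(i < N) (F i j - F (i + j).+1 j - F i (i + j).+1) =
  \sum_(i < N) F i i - 2 * \sum_(j < N) \sum_(N <= k < N + j.+1) F k j.
Proof.
move=> FC; under eq_bigr do rewrite !sumrB.
rewrite !sumrB.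
have -> : \sum_(j < N) \sum_(i < N) F i (i + j).+1 =
    \sum_(j < N) \sum_(i < N) F (i + j).+1 j.
  rewrite exchange_big; apply: eq_bigr => i _; apply: eq_bigr => j _.
  by rewrite FC addnC.
have -> : \sum_(j < N) \sum_(i < N) F (i + j).+1 j =
    \sum_(j < N) \sum_(k < N | (j < k)%N) F k j + \sum_(j < N) \sum_(N <= k < N + j.+1) F k j.
  rewrite -big_split/=; apply: eq_bigr => j _.
  have -> : \sum_(k < N | (j < k)%N) F k j = \sum_(j.+1 <= k < N) F k j.
    by rewrite big_geq_mkord.
  rewrite -(big_cat_nat (F := fun k => F k j)) ?leq_addr//.
  rewrite -{1}(add0n j.+1) big_addn addnK big_mkord.
  by apply: eq_bigr => i _; rewrite addnS.
have -> : \sum_(j < N) \sum_(i < N) F i j = \sum_(i < N) F i i +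
    2 * \sum_(j < N) \sum_(k < N | (j < k)%N) F k j.
  transitivity (\sum_(j < N) (F j j + (\sum_(k < N | (j < k)%N) F k j +
      \sum_(k < N | (k < j)%N) F k j))).
    apply: eq_bigr => j _; rewrite (bigD1 j)//=; congr (_ + _).
    rewrite (bigID (fun k : 'I_N => (j < k)%N))/=; congr (_ + _).
      apply: eq_bigl => k; rewrite -val_eqE /=; lia.
    apply: eq_bigl => k; rewrite -val_eqE /=; lia.
  rewrite !big_split/= [X in _ + (_ + X)](_ : _ = \sum_(j < N) \sum_(k < N | (j < k)%N) F k j); first by ring.
  rewrite (exchange_big_dep xpredT)//=; apply: eq_bigr => k _.
  by apply: eq_bigr => j _; rewrite FC.
by ring.
Qed.

(** With n <= N < m the three terms of the kernel are at most 1, 1/2 and 1 times 1 / (N n^3), whence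
    the 5/2. *)
Lemma zagier_le (R : realType) N m n : (0 < n <= N)%N -> (N < m)%N ->
  0 <= zagier R m n <= 5 / (2 * N%:R * n%:R ^+ 3).
Proof.
move=> /andP[n0 nN] Nm; rewrite /zagier.
have : N%:R <= m%:R :> R by rewrite ler_nat ltnW.
have : n%:R <= N%:R :> R by rewrite ler_nat.
have : 0 < n%:R :> R by rewrite ltr0n.
move: m%:R n%:R N%:R => x y z y0 yz zx.
have x0 : 0 < x by lra.
have z0 : 0 < z by lra.
apply/andP; split; first by rewrite !addr_ge0// invr_ge0 ?mulr_ge0 ?exprn_ge0 ?ltW.
have le (u v : R) : 0 < v -> v <= u -> u^-1 <= v^-1.
  by move=> v0 vu; rewrite lef_pV2 ?posrE//; apply: lt_le_trans vu.
have y3 : 0 < y ^+ 3 by rewrite exprn_gt0.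
have t1 : (x * y ^+ 3)^-1 <= (z * y ^+ 3)^-1.
  by apply: le; [rewrite mulr_gt0|rewrite ler_wpM2r// ltW].
have t2 : (2 * x ^+ 2 * y ^+ 2)^-1 <= (2 * z * y ^+ 3)^-1.
  apply: le; first by rewrite !mulr_gt0.
  have : z * y <= x ^+ 2 by rewrite expr2; nra.
  move=> /(ler_wpM2r (exprn_ge0 2 (ltW y0))); lra.
have t3 : (x ^+ 3 * y)^-1 <= (z * y ^+ 3)^-1.
  apply: le; first by rewrite mulr_gt0.
  have : z * y ^+ 2 <= x * x ^+ 2.
    by apply: ler_pM; rewrite ?exprn_ge0 ?lerXn2r ?nnegrE//; lra.
  by move=> /(ler_wpM2r (ltW y0)); lra.
have -> : 5 / (2 * z * y ^+ 3) = (z * y ^+ 3)^-1 + (2 * z * y ^+ 3)^-1 + (z * y ^+ 3)^-1.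
  by field; rewrite !gt_eqF.
lra.
Qed.

(** On the diagonal the kernel is 5 / (2 n^4). The boundary row of n has n terms of size at most 5 /
    (2 N n^3), so the boundary is O(1/N) because sum 1/n^2 converges. The value of pi never
    enters. *)
Lemma zeta2_sqr (R : realType) (z2 z4 : R) :
  hsum (fun k => (k%:R ^+ 2)^-1 : R) z2 -> hsum (fun k => (k%:R ^+ 4)^-1 : R) z4 ->
  2 * z2 ^+ 2 = 5 * z4.
Proof.
move=> h2 h4.
have shift s N : \sum_(1 <= k < N.+1) (k%:R ^+ s)^-1 = \sum_(i < N) (i.+1%:R ^+ s)^-1 :> R.
  by rewrite big_add1 big_mkord.
(* The sums are taken up to N + 1, so that the error is at most a multiple of [harmonic N], that is
   of 1 / (N + 1). *)
have c2 : (fun N => \sum_(i < N.+1) (i.+1%:R ^+ 2)^-1 : R) @ \oo --> z2.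
  have := hsum_series h2; rewrite expr0n/= invr0 => /(_ erefl).
  by rewrite -(cvg_shiftn 2) /=; under eq_fun do rewrite addn2 shift.
have c4 : (fun N => \sum_(i < N.+1) (i.+1%:R ^+ 4)^-1 : R) @ \oo --> z4.
  have := hsum_series h4; rewrite expr0n/= invr0 => /(_ erefl).
  by rewrite -(cvg_shiftn 2) /=; under eq_fun do rewrite addn2 shift.
pose E N : R := \sum_(j < N) \sum_(N <= k < N + j.+1) zagier R k.+1 j.+1.
have eqN N : 2 * (\sum_(i < N) (i.+1%:R ^+ 2)^-1 : R) ^+ 2 =
    5 * (\sum_(i < N) (i.+1%:R ^+ 4)^-1) - 4 * E N.
  have := @zagier_sum R (fun i j => zagier R i.+1 j.+1) N (fun i j => zagierC R _ _).
  rewrite -/(E N) (_ : \sum_(i < N) zagier R i.+1 i.+1 =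
      5 / 2 * \sum_(i < N) (i.+1%:R ^+ 4)^-1); last first.
    rewrite mulr_sumr; apply: eq_bigr => i _; rewrite /zagier.
    have := pnatr_eq0 R i.+1; move: (i.+1%:R : R) => y y0; field.
    by rewrite y0.
  rewrite (_ : \sum_(j < N) _ = (\sum_(i < N) (i.+1%:R ^+ 2)^-1) ^+ 2); first by move=> ->; field.
  rewrite expr2 big_distrlr/= exchange_big; apply: eq_bigr => i _; apply: eq_bigr => j _.
  rewrite -zagierE// addSn addnS; congr (_ - zagier _ _ _ - zagier _ _ _); lia.
have E0 N : 0 <= E N.
  apply: sumr_ge0 => j _; rewrite big_nat; apply: sumr_ge0 => k /andP[Nk _].
  by have /andP[] := @zagier_le R N k.+1 j.+1 (ltn_ord j) Nk.
have E1 N : E N.+1 <= 5 / 2 * z2 * harmonic N.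
  apply: le_trans (_ : \sum_(j < N.+1) 5 / (2 * N.+1%:R) * (j.+1%:R ^+ 2)^-1 <= _).
    apply: ler_sum => j _.
    apply: le_trans (_ : \sum_(N.+1 <= k < N.+1 + j.+1) 5 / (2 * N.+1%:R * j.+1%:R ^+ 3) <= _).
      rewrite big_nat [leRHS]big_nat; apply: ler_sum => k /andP[Nk _].
      by have /andP[] := @zagier_le R N.+1 k.+1 j.+1 (ltn_ord j) Nk.
    rewrite sumr_const_nat addKn -[leLHS]mulr_natl le_eqVlt; apply/orP; left; apply/eqP.
    have := pnatr_eq0 R j.+1; have := pnatr_eq0 R N.+1.
    move: (j.+1%:R : R) (N.+1%:R : R) => y z z0 y0; field.
    by rewrite z0 y0.
  rewrite -mulr_sumr /harmonic /= [leRHS](_ : _ = 5 / (2 * N.+1%:R) * z2); last first.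
    have := pnatr_eq0 R N.+1; move: (N.+1%:R : R) => z z0; field.
    by rewrite z0.
  rewrite ler_wpM2l ?divr_ge0 ?mulr_ge0// -shift.
  exact: hsum_seq_le h2 (iota_uniq _ _).
have Elim : (fun N => E N.+1) @ \oo --> 0.
  apply: (squeeze_cvgr _ (@cvg_cst _ 0 _ \oo _)); last first.
    by rewrite -[X in _ --> X](mulr0 (5 / 2 * z2)); apply: cvgMl_tmp; exact: cvg_harmonic.
  by apply: nearW => N; rewrite E0 E1.
have L : (fun N => 2 * (\sum_(i < N.+1) (i.+1%:R ^+ 2)^-1 : R) ^+ 2) @ \oo --> 2 * z2 ^+ 2.
  by apply: cvgMl_tmp; exact: cvgM.
have L' : (fun N => 2 * (\sum_(i < N.+1) (i.+1%:R ^+ 2)^-1 : R) ^+ 2) @ \oo --> 5 * z4.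
  under eq_fun do rewrite eqN.
  have := cvgB (cvgMl_tmp (a := 5) c4) (cvgMl_tmp (a := 4) Elim).
  rewrite mulr0 subr0; exact.
exact: (cvg_unique _ L L').
Qed.

(** * Asymptotics *)

Lemma sum_dvdn (R : realType) n l :
  \sum_(j < n) (l %| j.+1)%:R = (n %/ l)%:R :> R.
Proof.
by rewrite divn_count_dvd natr_sum big_add1 big_mkord.
Qed.

Lemma divn_ratio_le (R : realType) n l : (n %/ l)%:R / n%:R <= (l%:R)^-1 :> R.
Proof.
case: n => [|n]; first by rewrite invr0 mulr0 invr_ge0.
case: l => [|l]; first by rewrite divn0 invr0 mul0r.
rewrite ler_pdivrMr ?ltr0n// mulrC ler_pdivlMr ?ltr0n// -natrM ler_nat.
exact: leq_divM.
Qed.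

Lemma cvg_inv (R : realType) : (fun n => (n%:R)^-1 : R) @ \oo --> 0.
Proof. by rewrite -cvg_shiftS; exact: cvg_harmonic. Qed.

Lemma cvg_divn_ratio (R : realType) l :
  (fun n => (n %/ l)%:R / n%:R : R) @ \oo --> (l%:R^-1 : R).
Proof.
case: l => [|l].
  by under eq_fun do rewrite divn0 mul0r; rewrite invr0; exact: cvg_cst.
have cst : (fun _ : nat => (l.+1%:R)^-1 : R) @ \oo --> (l.+1%:R^-1 : R).
  exact: cvg_cst.
have low : (fun n => (l.+1%:R)^-1 - (n%:R)^-1 : R) @ \oo --> (l.+1%:R^-1 : R).
  by have := cvgB cst (@cvg_inv R); rewrite subr0; exact.
apply: (squeeze_cvgr _ low cst).
exists 1%N => // n /= n0; rewrite divn_ratio_le andbT lerBlDr.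
rewrite -(@ler_pM2r _ n%:R) ?ltr0n// mulrDl divfK ?mulVf ?pnatr_eq0 -?lt0n//.
rewrite mulrC ler_pdivrMr ?ltr0n// natr1 -natrM ler_nat.
by rewrite ltnW// ltn_ceil.
Qed.

Definition sigma_ratio (R : realType) (j : nat) : R := (sigma j)%:R / j%:R.

Lemma hsum_sigma_ratio (R : realType) j :
  hsum (fun d => (d %| j.+1)%:R * d%:R^-1 : R) (sigma_ratio R j.+1).
Proof.
have := @sigma_vecE R j.+1 ord_max; rewrite mxE -/(sigma_ratio R j.+1) => ->.
rewrite big_seq (eq_bigr (fun d => (d %| j.+1)%:R * d%:R^-1 : R)); last first.
  by move=> d; rewrite -dvdn_divisors// => ->; rewrite mul1r.
rewrite -big_seq; apply: hsum_fin => [|d|d]; rewrite ?divisors_uniq ?mulr_ge0 ?invr_ge0//.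
by rewrite -dvdn_divisors// => /negbTE ->; rewrite mul0r.
Qed.

Definition divisor_sum (R : realType) (n i : nat) : R :=
  \sum_(j < n) (i %| j.+1)%:R * sigma_ratio R j.+1.

(** Writing sigma(j)/j as the sum of 1/d over d | j, one counts the j <= n divisible by both i and
    d. *)
Lemma hsum_divisor_sum (R : realType) n i :
  hsum (fun d => (n %/ lcmn i d)%:R * d%:R^-1 : R) (divisor_sum R n i).
Proof.
have := @hsum_sum R nat 'I_n (index_enum _)
  (fun j d => (i %| j.+1)%:R * ((d %| j.+1)%:R * d%:R^-1))
  (fun j => (i %| j.+1)%:R * sigma_ratio R j.+1).
move=> /(_ (fun j => hsumZ (ler0n _ _) (hsum_sigma_ratio R j))); apply: hsum_ext => d.
rewrite -sum_dvdn mulr_suml; apply: eq_bigr => j _.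
by rewrite dvdn_lcm; case: (i %| _)%N; rewrite ?mul1r ?mul0r.
Qed.

(* [(A_n v_n)_i / n] for [1 <= i <= n]. *)
Definition scaled_image (R : realType) (n i : nat) : R :=
  if (0 < i <= n)%N then (divisor_sum R n i + (1 < i)%:R) / n%:R else 0.

(** The form in which c_i / i arises as a limit: floor(n / lcm(i, d)) / n tends to 1 / lcm(i, d) and
    never exceeds it, so this series is at once the limit and the majorant. *)
Lemma hsum_gcd_coef_lcm (R : realType) i : (0 < i)%N ->
  hsum (fun d => (lcmn i d)%:R^-1 * d%:R^-1 : R) (gcd_coef R i / i%:R).
Proof.
move=> i0; rewrite mulrC; apply: hsum_ext (hsumZ _ (hsum_gcd_coef R i0)); rewrite ?invr_ge0//.
move=> [|d]; first by rewrite !mulr0n expr0n/= invr0 !mulr0.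
have l0 : (0 < lcmn i d.+1)%N by rewrite lcmn_gt0 i0.
have -> : (gcdn d.+1 i)%:R = i%:R * d.+1%:R / (lcmn i d.+1)%:R :> R.
  by rewrite -natrM -muln_lcm_gcd gcdnC natrM mulrAC mulfV ?mul1r// pnatr_eq0 -lt0n.
have := pnatr_eq0 R d.+1; have := pnatr_eq0 R i; have := pnatr_eq0 R (lcmn i d.+1).
rewrite !eqn0Ngt l0 i0 /=; move: (lcmn _ _)%:R (i%:R : R) (d.+1%:R : R) => x y z x0 y0 z0.
by field; rewrite x0 y0 z0.
Qed.

Lemma divisor_sum_le (R : realType) n i : (0 < i)%N ->
  divisor_sum R n i / n%:R <= gcd_coef R i / i%:R.
Proof.
move=> i0; rewrite mulrC.
have n0 : 0 <= (n%:R)^-1 :> R by rewrite invr_ge0.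
apply: hsum_le (hsumZ n0 (hsum_divisor_sum R n i)) (hsum_gcd_coef_lcm R i0) => d.
by rewrite mulrA ler_wpM2r ?invr_ge0// mulrC divn_ratio_le.
Qed.

Lemma cvg_divisor_sum (R : realType) i : (0 < i)%N ->
  (fun n => divisor_sum R n i / n%:R) @ \oo --> gcd_coef R i / i%:R.
Proof.
move=> i0; apply: (hsum_cvg (hsum_gcd_coef_lcm R i0)
  (f := fun n d => n%:R^-1 * ((n %/ lcmn i d)%:R * d%:R^-1)) _ _ _ (hsum_gcd_coef_lcm R i0)).
- by move=> n d; rewrite mulrA ler_wpM2r ?invr_ge0// mulrC divn_ratio_le.
- move=> d; have := cvgMr_tmp (b := d%:R^-1) (@cvg_divn_ratio R (lcmn i d)).
  under eq_fun do rewrite (mulrC _%:R) -mulrA. exact.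
- move=> n; rewrite mulrC; apply: hsumZ (hsum_divisor_sum R n i).
  by rewrite invr_ge0.
Qed.

Lemma scaled_image_ge0 (R : realType) n i : 0 <= scaled_image R n i.
Proof.
rewrite /scaled_image; case: ifP => // _; rewrite divr_ge0// addr_ge0//.
exact: hsum_ge0 (hsum_divisor_sum R n i).
Qed.

(** One half of the bound is the divisor sum; the other pays for the extra 1 from the first column,
    since 1/n <= 1/i <= c_i / i. *)
Lemma scaled_image_le (R : realType) n i :
  scaled_image R n i <= 2 * (gcd_coef R i / i%:R).
Proof.
rewrite /scaled_image; case: ifPn => [/andP[i0 iN]|_]; last first.
  by rewrite mulr_ge0// -[X in _ / X]expr1 gcd_coef_div_ge0.
rewrite mulrDl mulr2n mulrDl !mul1r lerD ?divisor_sum_le//.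
apply: ler_pM; rewrite ?invr_ge0//.
  by apply: le_trans (gcd_coef_ge1 R i0); case: (1 < i)%N.
by rewrite lef_pV2 ?posrE ?ltr0n ?(leq_trans i0)// ler_nat.
Qed.

Lemma cvg_scaled_image (R : realType) i :
  (fun n => scaled_image R n i) @ \oo --> gcd_coef R i / i%:R.
Proof.
case: i => [|i].
  by rewrite invr0 mulr0; under eq_fun do rewrite /scaled_image/=; exact: cvg_cst.
have := cvgD (@cvg_divisor_sum R _ (ltn0Sn i)) (cvgMl_tmp (a := (1 < i.+1)%:R) (@cvg_inv R)).
rewrite mulr0 addr0 => /(_ _) h; apply: cvg_trans (h _); apply: near_eq_cvg.
exists i.+1 => // n /= iN.
by rewrite /scaled_image iN /= mulrDl.
Qed.

Lemma hsum_scaled_image (R : realType) n (F : nat -> R) :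
  (forall i, 0 <= F i) ->
  (forall i, ~~ (0 < i <= n)%N -> F i = 0) -> hsum F (\sum_(i < n) F i.+1).
Proof.
move=> F0 Fn; rewrite (_ : \sum_(i < n) _ = \sum_(i <- index_iota 1 n.+1) F i).
  apply: hsum_fin => [|//|i]; first exact: iota_uniq.
  by rewrite mem_index_iota ltnS; exact: Fn.
by rewrite big_add1 big_mkord.
Qed.

(** Squaring the divisor expansion and counting the j <= n divisible by both a and b gives floor(n /
    lcm(a, b)) / (n a b), dominated by its own limit gcd(a, b) / (a b)^2. *)
Lemma cvg_norm_sigma (R : realType) V :
  hsum (fun p : nat * nat =>
    (p.1%:R ^+ 2)^-1 * (p.2%:R ^+ 2)^-1 * (gcdn p.1 p.2)%:R : R) V ->
  (fun n => (\sum_(j < n) sigma_ratio R j.+1 ^+ 2) / n%:R) @ \oo --> V.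
Proof.
move=> hV.
have {}hV : hsum (fun p : nat * nat => (lcmn p.1 p.2)%:R^-1 * (p.1%:R^-1 * p.2%:R^-1) : R) V.
  apply: hsum_ext hV => -[[|a] [|b]] /=; rewrite ?mulr0n ?expr0n/= ?invr0 ?(mulr0, mul0r)//.
  have l0 : (0 < lcmn a.+1 b.+1)%N by rewrite lcmn_gt0.
  have -> : (gcdn a.+1 b.+1)%:R = a.+1%:R * b.+1%:R / (lcmn a.+1 b.+1)%:R :> R.
    by rewrite -natrM -muln_lcm_gcd natrM mulrAC mulfV ?mul1r// pnatr_eq0 -lt0n.
  have := pnatr_eq0 R a.+1; have := pnatr_eq0 R b.+1; have := pnatr_eq0 R (lcmn a.+1 b.+1).
  rewrite !eqn0Ngt l0 /=; move: (lcmn _ _)%:R (a.+1%:R : R) (b.+1%:R : R) => x y z x0 y0 z0.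
  by field; rewrite x0 y0 z0.
apply: (hsum_cvg hV
  (f := fun n p => n%:R^-1 * ((n %/ lcmn p.1 p.2)%:R * (p.1%:R^-1 * p.2%:R^-1))) _ _ _ hV).
- by move=> n p; rewrite mulrA ler_wpM2r ?mulr_ge0 ?invr_ge0// mulrC divn_ratio_le.
- move=> p; have := cvgMr_tmp (b := p.1%:R^-1 * p.2%:R^-1) (@cvg_divn_ratio R (lcmn p.1 p.2)).
  under eq_fun do rewrite (mulrC _%:R) -mulrA.
  exact.
move=> n; rewrite mulrC; apply: hsumZ; rewrite ?invr_ge0//.
have := @hsum_sum R (nat * nat)%type 'I_n (index_enum _) _ _
  (fun j => hsum_prod (hsum_sigma_ratio R j) (hsum_sigma_ratio R j)).
apply: hsum_ext => p; rewrite -sum_dvdn mulr_suml; apply: eq_bigr => j _.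
by rewrite dvdn_lcm; case: (_ %| _)%N; case: (_ %| _)%N; rewrite /= ?(mul1r, mul0r, mulr0).
Qed.

Lemma cvg_norm_image (R : realType) S :
  hsum (fun d => gcd_coef R d ^+ 2 / d%:R ^+ 2) S ->
  (fun n => \sum_(i < n) scaled_image R n i.+1 ^+ 2) @ \oo --> S.
Proof.
move=> hS; have {}hS : hsum (fun d => (gcd_coef R d / d%:R) ^+ 2) S.
  by apply: hsum_ext hS => d; rewrite expr_div_n.
apply: (hsum_cvg (hsumZ _ hS) (f := fun n i => scaled_image R n i ^+ 2) _ _ _ hS).
- exact: (ler0n _ 4).
- move=> n i; rewrite (_ : 4 * _ = (2 * (gcd_coef R i / i%:R)) ^+ 2); last by ring.
  by rewrite lerXn2r ?nnegrE ?scaled_image_le ?(le_trans _ (scaled_image_le _ n _))// scaled_image_ge0.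
- by move=> i; apply: cvgM; exact: cvg_scaled_image.
- move=> n; apply: hsum_scaled_image => [i|i /negbTE ni]; first exact: sqr_ge0.
  by rewrite /scaled_image ni expr0n.
Qed.

(** Every entry, the first included, is here given by the divisibility condition alone;
    [norm_gram_sigma_vec] makes the correction. The majorant carries 4 because each factor is at
    most twice its limit. *)
Lemma cvg_gram_image (R : realType) G :
  hsum (fun p : nat * nat => (gcd_coef R p.1 / p.1%:R ^+ 2) *
    (gcd_coef R p.2 / p.2%:R ^+ 2) * (gcdn p.1 p.2)%:R) G ->
  (fun n => (\sum_(j < n) (\sum_(i < n) (i.+1 %| j.+1)%:R * scaled_image R n i.+1) ^+ 2)
    / n%:R) @ \oo --> G.
Proof.
move=> hG.
have {}hG : hsum (fun p : nat * nat => (lcmn p.1 p.2)%:R^-1 *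
    ((gcd_coef R p.1 / p.1%:R) * (gcd_coef R p.2 / p.2%:R))) G.
  apply: hsum_ext hG => -[[|a] [|b]] /=; rewrite ?mulr0n ?expr0n/= ?invr0 ?(mulr0, mul0r)//.
  have l0 : (0 < lcmn a.+1 b.+1)%N by rewrite lcmn_gt0.
  have -> : (gcdn a.+1 b.+1)%:R = a.+1%:R * b.+1%:R / (lcmn a.+1 b.+1)%:R :> R.
    by rewrite -natrM -muln_lcm_gcd natrM mulrAC mulfV ?mul1r// pnatr_eq0 -lt0n.
  have := pnatr_eq0 R a.+1; have := pnatr_eq0 R b.+1; have := pnatr_eq0 R (lcmn a.+1 b.+1).
  rewrite !eqn0Ngt l0 /=; move: (lcmn _ _)%:R (a.+1%:R : R) (b.+1%:R : R) => x y z x0 y0 z0.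
  by field; rewrite x0 y0 z0.
apply: (hsum_cvg (hsumZ (ler0n R 4) hG)
  (f := fun n p => (n%:R^-1 * (n %/ lcmn p.1 p.2)%:R) *
    (scaled_image R n p.1 * scaled_image R n p.2)) _ _ _ hG).
- move=> n [a b] /=; rewrite [leRHS](_ : _ = (lcmn a b)%:R^-1 *
    ((2 * (gcd_coef R a / a%:R)) * (2 * (gcd_coef R b / b%:R)))); last by ring.
  apply: ler_pM; rewrite ?mulr_ge0 ?invr_ge0 ?scaled_image_ge0//.
    by rewrite mulrC divn_ratio_le.
  by apply: ler_pM; rewrite ?scaled_image_ge0 ?scaled_image_le.
- move=> [a b] /=; apply: cvgM; last by apply: cvgM; exact: cvg_scaled_image.
  by have := @cvg_divn_ratio R (lcmn a b); under eq_fun do rewrite mulrC.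
move=> n; rewrite mulrC.
have h j : hsum (fun i => (i %| j.+1)%:R * scaled_image R n i)
    (\sum_(i < n) (i.+1 %| j.+1)%:R * scaled_image R n i.+1).
  apply: (@hsum_scaled_image _ n (fun i => (i %| j.+1)%:R * scaled_image R n i)) => i.
    by rewrite mulr_ge0// scaled_image_ge0.
  by move=> /negbTE ni; rewrite /scaled_image ni mulr0.
have n0 : 0 <= n%:R^-1 :> R by rewrite invr_ge0.
have := hsumZ n0 (@hsum_sum R (nat * nat)%type 'I_n (index_enum _) _ _
  (fun j => hsum_prod (h j) (h j))).
apply: hsum_ext => p; rewrite -mulrA; congr (_ * _).
rewrite -sum_dvdn mulr_suml; apply: eq_bigr => j _.
by rewrite dvdn_lcm; case: (_ %| _)%N; case: (_ %| _)%N; rewrite /= ?(mul1r, mul0r, mulr0).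
Qed.

(* The summand [x_a x_b / n] vanishes unless [a, b <= n], so [1 / n <= 1 / sqrt (a b)] there. *)
Lemma cvg_sum_image (R : realType) :
  (fun n => (\sum_(i < n) scaled_image R n i.+1) ^+ 2 / n%:R) @ \oo --> (0 : R).
Proof.
have [Z hZ] := hsum_pow54 R; have Z0 := hsum_ge0 hZ.
(* So x_a = O(a^(-3/4)), and the factor (a b)^(-1/2) brings the majorant to (a b)^(-5/4). *)
have cr a : gcd_coef R a.+1 / a.+1%:R <= Z / root4 R a.+1 ^+ 3.
  have r0 : 0 < root4 R a.+1 by apply: lt_le_trans (root4_ge1 _ _).
  rewrite ler_pdivrMr ?ltr0n// natr_root4 mulrAC -mulrA.
  rewrite (_ : _ / _ = root4 R a.+1); first exact: gcd_coef_le.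
  by field; rewrite gt_eqF.
apply: (hsum_cvg (hsumZ (mulr_ge0 (ler0n R 4) (sqr_ge0 Z)) (hsum_prod hZ hZ))
  (f := fun n p => n%:R^-1 * (scaled_image R n p.1 * scaled_image R n p.2)) _ _ _ (hsum0 R _)).
- move=> n [a b] /=.
  have [->|a0] := posnP a.
    rewrite {1}/scaled_image/= mul0r mulr0; apply: mulr_ge0; first by rewrite mulr_ge0 ?sqr_ge0.
    by rewrite mulr_ge0 ?pow54_ge0.
  have [->|b0] := posnP b.
    rewrite {2}/scaled_image/= !mulr0; apply: mulr_ge0; first by rewrite mulr_ge0 ?sqr_ge0.
    by rewrite mulr_ge0 ?pow54_ge0.
  have bd : 0 <= 4 * Z ^+ 2 * (pow54 R a * pow54 R b).
    apply: mulr_ge0; first by rewrite mulr_ge0 ?sqr_ge0.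
    by rewrite mulr_ge0 ?pow54_ge0.
  have [an|na] := leqP a n; last first.
    by rewrite {1}/scaled_image (leqNgt a) na andbF mul0r mulr0.
  have [bn|nb] := leqP b n; last first.
    by rewrite {2}/scaled_image (leqNgt b) nb andbF !mulr0.
  have ra := lt_le_trans ltr01 (root4_ge1 R a0).
  have rb := lt_le_trans ltr01 (root4_ge1 R b0).
  apply: le_trans (_ : (root4 R a ^+ 2 * root4 R b ^+ 2)^-1 *
     ((2 * (Z / root4 R a ^+ 3)) * (2 * (Z / root4 R b ^+ 3))) <= _).
    apply: ler_pM; rewrite ?invr_ge0 ?mulr_ge0 ?scaled_image_ge0//.
      rewrite lef_pV2 ?posrE ?mulr_gt0 ?exprn_gt0 ?ltr0n ?(leq_trans a0)//.
      rewrite natr_root4 (exprD _ 2 2).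
      by rewrite ler_pM ?exprn_ge0 ?lerXn2r ?nnegrE ?root4_ge0 ?root4_le.
    apply: ler_pM; rewrite ?scaled_image_ge0//; apply: le_trans (scaled_image_le _ _ _) _.
      by rewrite ler_wpM2l//; case: a a0 {an ra bd} => // a _; exact: cr.
    by rewrite ler_wpM2l//; case: b b0 {bn rb bd} => // b _; exact: cr.
  rewrite !pow54E le_eqVlt; apply/orP; left; apply/eqP.
  by field; rewrite !gt_eqF.
- move=> [a b] /=; rewrite -(mul0r ((gcd_coef R a / a%:R) * (gcd_coef R b / b%:R))).
  by apply: cvgM; [exact: cvg_inv|apply: cvgM; exact: cvg_scaled_image].
move=> n; rewrite mulrC.
have n0 : 0 <= n%:R^-1 :> R by rewrite invr_ge0.
have h : hsum (scaled_image R n) (\sum_(i < n) scaled_image R n i.+1).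
  apply: hsum_scaled_image => [i|i /negbTE ni]; first exact: scaled_image_ge0.
  by rewrite /scaled_image ni.
exact: (hsumZ n0 (hsum_prod h h)).
Qed.

(** * The Redheffer matrix and the limit of the cosine *)

Lemma innerA (R : realType) n (A : 'M[R]_n) (u v : 'cV[R]_n) :
  inner u (A^T *m v) = inner (A *m u) v.
Proof.
rewrite /inner; under eq_bigr do rewrite mxE mulr_sumr.
rewrite exchange_big/=; apply: eq_bigr => i _; rewrite mxE mulr_suml.
by apply: eq_bigr => j _; rewrite mxE; ring.
Qed.

Lemma innerZ (R : realType) n (a b : R) (u v : 'cV[R]_n) :
  inner (a *: u) (b *: v) = a * b * inner u v.
Proof. by rewrite /inner mulr_sumr; apply: eq_bigr => i _; rewrite !mxE; ring. Qed.

(** Column 1 adds v_1 = 1 to every row except row 1, where 1 | 1 already accounts for that entry;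
    hence the term [(1 < i)%:R] in [scaled_image]. *)
Lemma redheffer_sigma_vec (R : realType) n (i : 'I_n) :
  (redheffer R n *m sigma_vec R n) i 0 = n%:R * scaled_image R n i.+1.
Proof.
have n0 : (0 < n)%N by exact: leq_ltn_trans (ltn_ord i).
rewrite /scaled_image ltn_ord /= mulrCA mulfV ?mulr1 ?pnatr_eq0 -?lt0n//.
rewrite mxE /divisor_sum.
rewrite (eq_bigr (fun j : 'I_n => (i.+1 %| j.+1)%:R * sigma_ratio R j.+1 +
   (0 < i)%:R * (j == 0%N :> nat)%:R)); last first.
  move=> j _; rewrite !mxE -/(sigma_ratio R j.+1) eqSS.
  case: eqP => [->|_]; last by rewrite mulr0 addr0.
  have -> : sigma_ratio R 1 = 1 by rewrite /sigma_ratio /sigma big_seq1 divr1.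
  by rewrite dvdn1 eqSS; case: (i : nat) => [|k] /=; rewrite !mulr1 ?(addr0, add0r).
rewrite big_split/= -mulr_sumr; congr (_ + _).
case: n n0 i => // n _ i; rewrite big_ord_recl/= big1 ?addr0 ?mulr1//.
Qed.

Lemma redheffer_gram_sigma_vec (R : realType) n (j : 'I_n) :
  ((redheffer R n)^T *m redheffer R n *m sigma_vec R n) j 0 =
  n%:R * (if j == 0%N :> nat then \sum_(i < n) scaled_image R n i.+1
          else \sum_(i < n) (i.+1 %| j.+1)%:R * scaled_image R n i.+1).
Proof.
rewrite -mulmxA mxE; under eq_bigr do rewrite redheffer_sigma_vec !mxE eqSS.
case: ifP => j0; rewrite mulr_sumr; apply: eq_bigr => i _; rewrite /= ?mul1r//.
by rewrite mulrCA.
Qed.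

(** The divisibility condition would make the first entry x_1, while row 1 of the transpose is all
    ones and makes it the sum of all x_i. The one square is subtracted and the other added; both
    corrections vanish in the limit. *)
Lemma norm_gram_sigma_vec (R : realType) n (w := (redheffer R n.+1)^T *m redheffer R n.+1 *m sigma_vec R n.+1) :
  inner w w = n.+1%:R ^+ 3 *
   ((\sum_(j < n.+1) (\sum_(i < n.+1) (i.+1 %| j.+1)%:R * scaled_image R n.+1 i.+1) ^+ 2) / n.+1%:R
    - scaled_image R n.+1 1 ^+ 2 * n.+1%:R^-1
    + (\sum_(i < n.+1) scaled_image R n.+1 i.+1) ^+ 2 / n.+1%:R).
Proof.
rewrite /inner; under eq_bigr do rewrite redheffer_gram_sigma_vec.
rewrite (eq_bigr (fun j : 'I_n.+1 => n.+1%:R ^+ 2 * (if j == 0%N :> nat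
    then \sum_(i < n.+1) scaled_image R n.+1 i.+1
    else \sum_(i < n.+1) (i.+1 %| j.+1)%:R * scaled_image R n.+1 i.+1) ^+ 2)); last first.
  by move=> j _; ring.
rewrite -mulr_sumr big_ord_recl [X in _ = _ * (X / _ - _ + _)]big_ord_recl /=.
rewrite (_ : \sum_(i < n.+1) (i.+1 %| 1)%:R * _ = scaled_image R n.+1 1); last first.
  by rewrite big_ord_recl/= mul1r big1 ?addr0// => i _; rewrite mul0r.
have := pnatr_eq0 R n.+1; move: (n.+1%:R : R) => y y0; field.
by rewrite y0.
Qed.

Lemma cvg_cosine (R : realType) (V S G : R) :
  hsum (fun p : nat * nat =>
    (p.1%:R ^+ 2)^-1 * (p.2%:R ^+ 2)^-1 * (gcdn p.1 p.2)%:R : R) V ->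
  hsum (fun d => gcd_coef R d ^+ 2 / d%:R ^+ 2) S ->
  hsum (fun p : nat * nat => (gcd_coef R p.1 / p.1%:R ^+ 2) *
    (gcd_coef R p.2 / p.2%:R ^+ 2) * (gcdn p.1 p.2)%:R) G ->
  0 < V -> 0 < G ->
  (fun n : nat =>
     let A := redheffer R n in
     let v := sigma_vec R n in
     let w := A^T *m A *m v in
     inner ((enorm v)^-1 *: v) ((enorm w)^-1 *: w)) @ \oo -->
  S / (Num.sqrt V * Num.sqrt G).
Proof.
move=> hV hS hG V0 G0 /=.
have cV := cvg_norm_sigma hV; have cS := cvg_norm_image hS.
pose g n : R := (\sum_(j < n) (\sum_(i < n) (i.+1 %| j.+1)%:R * scaled_image R n i.+1) ^+ 2) / n%:R
    - scaled_image R n 1 ^+ 2 * n%:R^-1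
    + (\sum_(i < n) scaled_image R n i.+1) ^+ 2 / n%:R.
have cG : g @ \oo --> G.
  have h1 : (fun n => scaled_image R n 1 ^+ 2 * n%:R^-1) @ \oo --> (0 : R).
    have := cvgM (cvgM (@cvg_scaled_image R 1) (@cvg_scaled_image R 1)) (@cvg_inv R).
    by rewrite mulr0; exact.
  have := cvgD (cvgB (cvg_gram_image hG) h1) (@cvg_sum_image R).
  by rewrite subr0 addr0; exact.
have csV : (fun n => Num.sqrt ((\sum_(j < n) sigma_ratio R j.+1 ^+ 2) / n%:R)) @ \oo
    --> Num.sqrt V by exact: (continuous_cvg _ (@sqrt_continuous R V) cV).
have csG : (fun n => Num.sqrt (g n)) @ \oo --> Num.sqrt G.
  exact: (continuous_cvg _ (@sqrt_continuous R G) cG).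
have nz : Num.sqrt V * Num.sqrt G != 0 by rewrite mulf_neq0// gt_eqF// sqrtr_gt0.
apply: cvg_trans (cvgM cS (cvgV nz (cvgM csV csG))).
(* For n >= 1 the identity is exact: <v, A^T A v> = |A v|^2 has scale n^2, which cancels n^(1/2)
   from |v| and n^(3/2) from |A^T A v|. *)
apply: near_eq_cvg; exists 1%N => // -[//|n] _ /=.
rewrite innerZ /enorm norm_gram_sigma_vec -/(g n.+1) -mulmxA innerA.
have -> : inner (sigma_vec R n.+1) (sigma_vec R n.+1) =
    n.+1%:R * ((\sum_(j < n.+1) sigma_ratio R j.+1 ^+ 2) / n.+1%:R).
  rewrite mulrCA mulfV ?mulr1 ?pnatr_eq0//.
  by apply: eq_bigr => i _; rewrite !mxE expr2.
have -> : inner (redheffer R n.+1 *m sigma_vec R n.+1) (redheffer R n.+1 *m sigma_vec R n.+1) =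
    n.+1%:R ^+ 2 * \sum_(i < n.+1) scaled_image R n.+1 i.+1 ^+ 2.
  rewrite /inner mulr_sumr; apply: eq_bigr => i _.
  by rewrite redheffer_sigma_vec; ring.
have s3 : Num.sqrt (n.+1%:R ^+ 3) = n.+1%:R * Num.sqrt n.+1%:R :> R.
  by rewrite exprSr sqrtrM ?exprn_ge0// sqrtr_sqr ger0_norm.
rewrite [Num.sqrt (n.+1%:R * _)]sqrtrM// [Num.sqrt (n.+1%:R ^+ 3 * _)]sqrtrM ?exprn_ge0// s3.
have s0 : 0 < Num.sqrt n.+1%:R :> R by rewrite sqrtr_gt0.
have s2 : Num.sqrt n.+1%:R ^+ 2 = n.+1%:R :> R by rewrite sqr_sqrtr.
move: (Num.sqrt (_ / _)) (Num.sqrt (g n.+1)) => x z {s3}.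
move: s0 s2; move: (Num.sqrt n.+1%:R) => s s0 s2.
rewrite -s2 !invfM; move: (x^-1) (z^-1) => a b.
by field; rewrite gt_eqF.
Qed.

(** * Euler factors *)

Lemma hsum_shift (R : realType) (f : nat -> R) m l : (forall i, 0 <= f i) ->
  hsum (fun j => (m <= j)%:R * f j) l <-> hsum (fun i => f (m + i)%N) l.
Proof.
move=> f0; have inj : injective (addn m) by exact: addnI.
have F0 i : 0 <= (m <= i)%:R * f i by rewrite mulr_ge0.
have sur i : (m <= i)%:R * f i != 0 -> exists j, (m + j)%N = i.
  case: (leqP m i) => [mi _|_]; last by rewrite mul0r eqxx.
  by exists (i - m)%N; rewrite subnKC.
rewrite (hsum_reindex l inj F0 sur).
suff -> : (fun j => (m <= j)%:R * f j) \o addn m = fun i => f (m + i)%N by [].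
by apply/funext => i /=; rewrite leq_addr mul1r.
Qed.

Lemma hsum_geometric (R : realType) (y : R) : 0 <= y < 1 ->
  hsum (fun k => y ^+ k) (1 - y)^-1.
Proof.
move=> /andP[y0 y1]; have y1' : 0 < 1 - y by rewrite subr_gt0.
have yn : `|y| < 1 by rewrite ger0_norm.
have E N : \sum_(0 <= i < N) y ^+ i = series (geometric 1 y) N.
  by apply: eq_bigr => i _; rewrite /geometric /= mul1r.
apply: hsum_of_series_cvg => [i|N|]; first exact: exprn_ge0.
  rewrite E geometric_seriesE ?lt_eqF//= mul1r ler_pdivrMr// mulVf ?gt_eqF//.
  by rewrite gerBl exprn_ge0.
under eq_fun do rewrite E.
by have := @cvg_geometric_series R 1 y yn; rewrite mul1r; exact.
Qed.

Lemma hsum_split_prime (R : realType) p (F : nat -> R) l : prime p ->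
  (forall i, 0 <= F i) -> F 0%N = 0 ->
  hsum F l <-> hsum (fun kq : nat * nat => (coprime p kq.2)%:R * F (p ^ kq.1 * kq.2)%N) l.
Proof.
move=> pp F0 F00.
apply: (hsum_reindex_in (P := fun kq : nat * nat => coprime p kq.2)
  (e := fun kq => (p ^ kq.1 * kq.2)%N)) => //.
- have p1 := prime_gt1 pp.
  have pos q : coprime p q -> (0 < q)%N.
    by case: q => //; rewrite /coprime gcdn0 => /eqP p1'; rewrite p1' in p1.
  have lg k q : coprime p q -> logn p (p ^ k * q) = k.
    move=> c; have q0 := pos q c; have pk0 : (0 < p ^ k)%N by rewrite expn_gt0 prime_gt0.
    by rewrite lognM// pfactorK// logn_coprime// addn0.
  move=> [k q] [k' q']; rewrite !unfold_in /= => c c' e.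
  have ek : k = k' by rewrite -(lg k q c) e lg.
  move: e; rewrite ek => /eqP; rewrite eqn_pmul2l ?expn_gt0 ?prime_gt0// => /eqP ->.
  by [].
- move=> [|j]; first by rewrite F00 eqxx.
  move=> _; have [q c ->] := pfactor_coprime pp (ltn0Sn j).
  by exists (logn p j.+1, q) => //=; rewrite mulnC.
Qed.

(** The weight at p^k is (1 - 1/p) p^(-3k) for k >= 1, but 1 for k = 0; the last term makes up the
    difference and is the origin of the summand [x] in [geo]. *)
Lemma weight_pow (R : realType) p k : prime p ->
  weight R (p ^ k) = (1 - p%:R^-1) * (p%:R^-1 ^+ 3) ^+ k + (k == 0%N)%:R * p%:R^-1.
Proof.
move=> pp; have p0 : p%:R != 0 :> R by rewrite pnatr_eq0 -lt0n prime_gt0.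
rewrite /weight; case: k => [|k].
  by rewrite expn0 (_ : totient 1 = 1%N)// expr1n !expr0 divr1 mulr1 mul1r subrK.
have e : p%:R^-1 ^+ 3 ^+ k.+1 = (p%:R ^+ 3 * (p%:R ^+ k) ^+ 3)^-1 :> R.
  by rewrite !exprVn exprS -!exprM mulnC.
rewrite totient_pfactor// natrM -subn1 natrB ?prime_gt0// !natrX mul0r addr0 (exprS _ k) e.
have := expf_neq0 k p0; move: (p%:R ^+ k) {e} => y y0.
by field; rewrite p0 y0.
Qed.

Lemma weight_mul (R : realType) m n : coprime m n ->
  weight R (m * n) = weight R m * weight R n.
Proof. by move=> c; rewrite /weight totient_coprime// !natrM exprMn invfM mulrACA. Qed.

Definition sifted_weight (R : realType) (N q : nat) : R := (coprime N q)%:R * weight R q.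

Lemma sifted_weight_ge0 (R : realType) N q : 0 <= sifted_weight R N q.
Proof. by rewrite mulr_ge0 ?weight_ge0. Qed.

Lemma sifted_weight0 (R : realType) N : sifted_weight R N 0 = 0.
Proof. by rewrite /sifted_weight weight0 mulr0. Qed.

(* [A = |1|^2], [B = <1, h>] and [C = |h|^2] in [l^2] of the weight restricted
   to the integers prime to [N]. *)
Definition spectral (R : realType) (N : nat) (h : nat -> R) (A B C : R) : Prop :=
  [/\ hsum (sifted_weight R N) A,
      forall q, (0 < q)%N -> coprime N q ->
        hsum (fun e => sifted_weight R N e * (gcdn e q)%:R ^+ 2) (h q),
      hsum (fun q => sifted_weight R N q * h q) B &
      hsum (fun q => sifted_weight R N q * h q ^+ 2) C].

Section LocalFactor.
Variables (R : realType) (p : nat).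
Hypothesis pp : prime p.
Let x : R := p%:R^-1.

Let x01 : 0 < x < 1.
Proof. by rewrite invr_gt0 ltr0n prime_gt0//= invf_lt1 ?ltr1n ?ltr0n ?prime_gt1 ?prime_gt0. Qed.

(* [geo s] is the sum of [weight (p ^ k) * x ^ (s k)] over [k >= 0]. *)
Definition geo (x : R) (s : nat) : R := (1 - x) / (1 - x ^+ (3 + s)) + x.

Let xs s : 0 <= x ^+ s.+1 < 1.
Proof.
have /andP[x0 x1] := x01.
by rewrite exprn_ge0 ?ltW// exprn_ilt1// ltW.
Qed.

Lemma hsum_geo s : hsum (fun k => weight R (p ^ k) * x ^+ (s * k)) (geo x s).
Proof.
have /andP[x0 x1] := x01.
have h1 : 0 <= 1 - x by lra.
have h2 := hsumZ h1 (hsum_geometric (xs (2 + s))).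
have h3 : hsum (fun k => (k == 0%N)%:R * x) x.
  have := @hsum_fin R nat (fun k => (k == 0%N)%:R * x) [:: 0%N] isT.
  rewrite big_seq1 eqxx mul1r; apply=> [i|i]; first by rewrite mulr_ge0// ltW.
  by rewrite inE => /negbTE ->; rewrite mul0r.
apply: hsum_ext (hsumD h2 h3) => k; rewrite weight_pow// -/x.
rewrite [RHS]mulrDl; congr (_ + _).
  by rewrite -[RHS]mulrA; congr (_ * _); rewrite -!exprM -exprD -mulnDl.
by case: k => [|k]; rewrite ?(muln0, expr0, mulr1, mul0r).
Qed.

(** Coefficients of the local factor u - v x^k that h acquires at p^k. *)
Definition local_v (x : R) : R := x * (1 - x ^+ 2) / (1 - x ^+ 3).
Definition local_u (x : R) : R := geo x 0 + local_v x.

(** Passing from k to k + 1 affects only the terms j > k, whose factor p^(2k) becomes p^(2k+2).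
    Times the geometric tail of the weights this is v (x^k - x^(k+1)), so the induction
    telescopes. *)
Lemma hsum_local_gcd k :
  hsum (fun j => weight R (p ^ j) * (p ^ minn j k)%:R ^+ 2) (local_u x - local_v x * x ^+ k).
Proof.
have /andP[x0 x1] := x01.
have p0 : p%:R != 0 :> R by rewrite pnatr_eq0 -lt0n prime_gt0.
have x3 : 1 - x ^+ 3 != 0 by rewrite subr_eq0 gt_eqF//; case/andP: (xs 2).
elim: k => [|k IH].
  rewrite /local_u /local_v expr0 mulr1 addrK; apply: hsum_ext (hsum_geo 0) => j.
  by rewrite minn0 expn0 mul0n expr0 expr1n !mulr1.
have tail : hsum (fun j => (k.+1 <= j)%:R * weight R (p ^ j))
    ((1 - x) * x ^+ (3 * k.+1) / (1 - x ^+ 3)).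
  apply/hsum_shift => [j|]; first exact: weight_ge0.
  have c0 : 0 <= (1 - x) * x ^+ (3 * k.+1) by rewrite mulr_ge0 ?exprn_ge0; lra.
  apply: hsum_ext (hsumZ c0 (hsum_geometric (xs 2))) => j.
  rewrite weight_pow// -/x addSn mul0r addr0 -!exprM -mulrA -exprD.
  by congr (_ * _ ^+ _); lia.
have c0 : 0 <= (p ^ k.+1)%:R ^+ 2 - (p ^ k)%:R ^+ 2 :> R.
  by rewrite subr_ge0 lerXn2r ?nnegrE// ler_nat leq_pexp2l ?prime_gt0.
have := hsumD IH (hsumZ c0 tail).
rewrite (_ : _ + _ = local_u x - local_v x * x ^+ k.+1); last first.
  have px : p%:R = x^-1 by rewrite /x invrK.
  have x0' : x != 0 by rewrite gt_eqF.
  have e3 : x ^+ (3 * k.+1) = x ^+ 3 * (x ^+ k) ^+ 3.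
    by rewrite mulnS exprD (mulnC 3 k) exprM.
  rewrite /local_u /local_v !natrX !(exprS _ k) e3.
  have -> : p%:R ^+ k = (x ^+ k)^-1 :> R by rewrite px exprVn.
  rewrite px; have y0 := expf_neq0 k x0'; move: (x ^+ k) y0 => y y0.
  move: (geo x 0) => g; field.
  by rewrite x3 x0' y0.
apply: hsum_ext => j; case: (ltnP k j) => kj.
  by rewrite (minn_idPr kj) mul1r mulrBl; ring.
by rewrite (minn_idPl (leqW kj)) mul0r mulr0 addr0.
Qed.

(* The Euler factors of [A], [B] and [C] at [p = 1 / x]. *)
Definition local_A (x : R) : R := geo x 0.
Definition local_B (x : R) : R := local_u x * geo x 0 - local_v x * geo x 1.
Definition local_C (x : R) : R :=
  local_u x ^+ 2 * geo x 0 + local_v x ^+ 2 * geo x 2 - 2 * local_u x * local_v x * geo x 1.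

Let lam k := local_u x - local_v x * x ^+ k.

Let lam0 k : 0 <= lam k.
Proof. exact: hsum_ge0 (hsum_local_gcd k). Qed.

Let v0 : 0 <= local_v x.
Proof.
have /andP[x0 x1] := x01; have /andP[_ x2] := xs 1; have /andP[_ x3] := xs 2.
by rewrite divr_ge0 ?mulr_ge0//; lra.
Qed.

Let u0 : 0 <= local_u x.
Proof.
by have := lam0 0; rewrite /lam expr0 mulr1 subr_ge0; exact: le_trans.
Qed.

Lemma hsum_local_B : hsum (fun k => weight R (p ^ k) * lam k) (local_B x).
Proof.
have w0 k := weight_ge0 R (p ^ k).
have le k : local_v x * (weight R (p ^ k) * x ^+ (1 * k)) <=
    local_u x * (weight R (p ^ k) * x ^+ (0 * k)).
  rewrite mul1n mul0n -subr_ge0 (_ : _ - _ = weight R (p ^ k) * lam k) ?mulr_ge0//.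
  by rewrite /lam; ring.
apply: hsum_ext (hsumB le (hsumZ v0 (hsum_geo 1)) (hsumZ u0 (hsum_geo 0))) => k.
by rewrite mul1n mul0n /lam; ring.
Qed.

Lemma hsum_local_C : hsum (fun k => weight R (p ^ k) * lam k ^+ 2) (local_C x).
Proof.
have w0 k := weight_ge0 R (p ^ k).
have uv0 : 0 <= 2 * local_u x * local_v x by apply: mulr_ge0 v0; exact: mulr_ge0 u0.
(* The positive part of the expanded square of u - v x^k; the cross term is subtracted afterwards by
   [hsumB]. *)
pose g k := local_u x ^+ 2 * (weight R (p ^ k) * x ^+ (0 * k)) +
  local_v x ^+ 2 * (weight R (p ^ k) * x ^+ (2 * k)).
have hg : hsum g (local_u x ^+ 2 * geo x 0 + local_v x ^+ 2 * geo x 2).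
  by apply: hsumD; apply: hsumZ (hsum_geo _); exact: sqr_ge0.
have gE k : g k = weight R (p ^ k) * lam k ^+ 2 +
    2 * local_u x * local_v x * (weight R (p ^ k) * x ^+ (1 * k)).
  by rewrite /g mul0n mul1n (mulnC 2) exprM /lam; ring.
have le k : 2 * local_u x * local_v x * (weight R (p ^ k) * x ^+ (1 * k)) <= g k.
  by rewrite gE lerDr mulr_ge0 ?sqr_ge0.
by apply: hsum_ext (hsumB le (hsumZ uv0 (hsum_geo 1)) hg) => k; rewrite gE addrK.
Qed.

End LocalFactor.

(** Summability of [g] is read off the row of index 0 of the product family, since [f 0] is
    nonzero. *)
Lemma hsum_factor (R : realType) (f g : nat -> R) s l :
  hsum f s -> 0 < f 0%N -> (forall j, 0 <= g j) ->
  hsum (fun kq : nat * nat => f kq.1 * g kq.2) l ->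
  exists2 m, hsum g m & l = s * m.
Proof.
move=> hf f0 g0 hl; have [r hr] := hsum_row (f := fun k q => f k * g q) hl.
have f0' : 0 <= (f 0%N)^-1 by rewrite invr_ge0 ltW.
have hg : hsum g ((f 0%N)^-1 * r 0%N).
  by apply: hsum_ext (hsumZ f0' (hr 0%N)) => q; rewrite mulKf// gt_eqF.
by exists ((f 0%N)^-1 * r 0%N) => //; exact: hsum_uniq hl (hsum_prod hf hg).
Qed.

Lemma gcdn_pow_mul p j k e q : coprime p e -> coprime p q ->
  gcdn (p ^ j * e) (p ^ k * q) = (p ^ minn j k * gcdn e q)%N.
Proof.
move=> ce cq.
wlog jk : j k e q ce cq / (j <= k)%N.
  move=> H; case: (leqP j k) => [jk|/ltnW kj]; first by rewrite H// (minn_idPl jk).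
  by rewrite gcdnC H// (minn_idPl kj) gcdnC.
rewrite (minn_idPl jk) -(subnKC jk) expnD -mulnA -muln_gcdr Gauss_gcdr//.
by rewrite coprime_sym coprimeXl.
Qed.

Lemma sifted_weight_split (R : realType) p N k q : prime p -> coprime p N ->
  (coprime p q)%:R * sifted_weight R N (p ^ k * q) =
  weight R (p ^ k) * sifted_weight R (p * N) q.
Proof.
move=> pp cN; rewrite /sifted_weight coprimeMl.
case: (boolP (coprime p q)) => cq; last by rewrite !mul0r mulr0.
rewrite coprimeMr (coprimeXr k) 1?coprime_sym//= weight_mul ?coprimeXl//.
by rewrite mul1r mulrCA.
Qed.

(** Both the weight and the gcd split along p^k q, so h(p^k q) = (u - v x^k) h'(q), with h' the
    function attached to the integers prime to p N. The three sums then split off their factors at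
    p. *)
Lemma spectral_strip (R : realType) p N (h : nat -> R) A B C (x := p%:R^-1 : R) :
  prime p -> coprime p N -> spectral N h A B C ->
  exists h' A' B' C', spectral (p * N) h' A' B' C' /\
    [/\ A = local_A x * A', B = local_B x * B' & C = local_C x * C'].
Proof.
move=> pp cN [hA hh hB hC].
have w0 := sifted_weight_ge0 R N; have w00 := sifted_weight0 R N.
have h0 q : 0 <= sifted_weight R N q * h q by exact: hB.1.
have wp0 : weight R (p ^ 0) = 1 by rewrite expn0 /weight expr1n divr1.
have [A' hA' eA] : exists2 A', hsum (sifted_weight R (p * N)) A' & A = local_A x * A'.
  have := (hsum_split_prime A pp w0 w00).1 hA; rewrite (_ : (fun kq => _) =
    (fun kq => weight R (p ^ kq.1) * sifted_weight R (p * N) kq.2)); last first.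
    by apply/funext => kq; rewrite sifted_weight_split.
  have hg : hsum (fun k => weight R (p ^ k)) (local_A x).
    by apply: hsum_ext (hsum_geo R pp 0) => k; rewrite mul0n expr0 mulr1.
  by apply: (hsum_factor hg) => [|q]; [rewrite wp0|exact: sifted_weight_ge0].
pose lam k := local_u x - local_v x * x ^+ k.
have l0 : 0 < lam 0%N.
  have := hsum_seq_le (s := [:: 0%N]) (hsum_local_gcd R pp 0) isT.
  rewrite big_seq1 wp0 min0n expn0 expr1n mulr1 -/x -/(lam 0%N).
  exact: lt_le_trans.
have : forall q, exists h'q, (0 < q)%N -> coprime (p * N) q ->
  hsum (fun e => sifted_weight R (p * N) e * (gcdn e q)%:R ^+ 2) h'q /\
  forall k, h (p ^ k * q)%N = lam k * h'q.
  move=> q; case: (boolP ((0 < q)%N && coprime (p * N) q)); last first.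
    by rewrite negb_and => nq; exists 0 => h1 h2; rewrite h1 h2 in nq.
  rewrite coprimeMl => /andP[q0 /andP[cpq cNq]].
  have key k : hsum (fun je : nat * nat => (weight R (p ^ je.1) * (p ^ minn je.1 k)%:R ^+ 2) *
      (sifted_weight R (p * N) je.2 * (gcdn je.2 q)%:R ^+ 2)) (h (p ^ k * q)%N).
    have cq : coprime N (p ^ k * q) by rewrite coprimeMr cNq andbT coprimeXr// coprime_sym.
    have pq0 : (0 < p ^ k * q)%N by rewrite muln_gt0 expn_gt0 prime_gt0.
    have hhq := hh _ pq0 cq.
    have F0 : sifted_weight R N 0 * (gcdn 0 (p ^ k * q))%:R ^+ 2 = 0 by rewrite w00 mul0r.
    apply: hsum_ext ((hsum_split_prime _ pp hhq.1 F0).1 hhq) => -[j e] /=.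
    rewrite mulrA sifted_weight_split//.
    case: (boolP (coprime p e)) => ce; first by rewrite gcdn_pow_mul// natrM; ring.
    by rewrite /sifted_weight coprimeMl (negbTE ce) !(mul0r, mulr0).
  have g0 e : 0 <= sifted_weight R (p * N) e * (gcdn e q)%:R ^+ 2.
    by rewrite mulr_ge0 ?exprn_ge0// sifted_weight_ge0.
  have f0 k : 0 < weight R (p ^ 0) * (p ^ minn 0 k)%:R ^+ 2.
    by rewrite wp0 min0n expn0 expr1n mulr1.
  have fact k := hsum_factor (hsum_local_gcd R pp k) (f0 k) g0 (key k).
  (* Each k provides a cofactor, but all of them are the sum of the same family, so the one found at
     k = 0 serves for every k. *)
  have [h'q hh'q _] := fact 0%N.
  exists h'q => _ _; split => // k.
  have [m hm ->] := fact k.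
  by rewrite (hsum_uniq hm hh'q).
move=> /choice[h' hh'].
have split_pow s k q : (coprime p q)%:R * (sifted_weight R N (p ^ k * q) * h (p ^ k * q)%N ^+ s) =
    weight R (p ^ k) * lam k ^+ s * (sifted_weight R (p * N) q * h' q ^+ s).
  rewrite mulrA sifted_weight_split//.
  have [->|q0] := posnP q; first by rewrite sifted_weight0 !(mulr0, mul0r).
  case: (boolP (coprime (p * N) q)) => cq; last by rewrite /sifted_weight (negbTE cq) !(mulr0, mul0r).
  by have [_ ->] := hh' q q0 cq; rewrite exprMn; ring.
have h'0 s q : 0 <= sifted_weight R (p * N) q * h' q ^+ s.
  have [->|q0] := posnP q; first by rewrite sifted_weight0 mul0r.
  case: (boolP (coprime (p * N) q)) => cq; last by rewrite /sifted_weight (negbTE cq) !mul0r.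
  have [hq _] := hh' q q0 cq.
  by rewrite mulr_ge0 ?sifted_weight_ge0// exprn_ge0// (hsum_ge0 hq).
have hs s l c : hsum (fun q => sifted_weight R N q * h q ^+ s) l ->
    hsum (fun k => weight R (p ^ k) * lam k ^+ s) c ->
    exists2 m, hsum (fun q => sifted_weight R (p * N) q * h' q ^+ s) m & l = c * m.
  move=> hl hc; apply: (hsum_factor hc) => //.
    by rewrite wp0 mul1r exprn_gt0.
  have F0 : sifted_weight R N 0 * h 0%N ^+ s = 0 by rewrite w00 mul0r.
  by apply: hsum_ext ((hsum_split_prime _ pp hl.1 F0).1 hl) => -[k q] /=.
have [B' hB' eB] := hs 1%N B (local_B x) hB (hsum_local_B R pp).
have [C' hC' eC] := hs 2 C (local_C x) hC (hsum_local_C R pp).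
exists h', A', B', C'; split => //; split => //.
by move=> q q0 cq; have [] := hh' q q0 cq.
Qed.

(** * The variance of h *)

(** An entry is at most its row sum, so the columns are dominated by [g]. *)
Lemma hsum_cols (R : realType) (T1 T2 : choiceType) (f : T1 -> T2 -> R) g l :
  (forall i, hsum (f i) (g i)) -> hsum g l ->
  exists2 g', forall j, hsum (f^~ j) (g' j) & hsum g' l.
Proof.
move=> hf hg; have f0 i j : 0 <= f i j by case: (hf i).
have H j : exists k, hsum (f^~ j) k.
  have [|k hk _] := hsum_dom _ hg (f := f^~ j); last by exists k.
  by move=> i; rewrite f0/=; have := hsum_seq_le (s := [:: j]) (hf i) isT; rewrite big_seq1.
have [g' hg'] := choice H; exists g' => //.
exact: hsum_swap hf hg' hg.
Qed.

(** Telescoping: 1/k^3 <= 1/((k-1) k (k+1)), which is half of 1/((k-1) k) - 1/(k (k+1)). *)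
Lemma hsum_tail_cube (R : realType) m :
  exists2 l, hsum (fun k => (m.+1 < k)%:R * (k%:R ^+ 3)^-1 : R) l &
    l <= (2 * m.+2%:R * m.+1%:R)^-1.
Proof.
pose f (k : nat) : R := (k%:R ^+ 3)^-1.
have f0 k : 0 <= f k by rewrite invr_ge0 exprn_ge0.
suff [l hl ll] : exists2 l, hsum (fun i => f (m.+2 + i)%N) l & l <= (2 * m.+2%:R * m.+1%:R)^-1.
  by exists l => //; apply/(hsum_shift (f := f)).
apply: hsum_of_series_bounded => [i|n]; first exact: f0.
suff : \sum_(0 <= i < n) f (m.+2 + i)%N <= (2 * m.+2%:R * m.+1%:R)^-1 -
    (2 * (m + n).+2%:R * (m + n).+1%:R)^-1.
  by move/le_trans; apply; rewrite gerBl invr_ge0 !mulr_ge0.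
elim: n => [|n IH]; first by rewrite big_nil addn0 subrr.
rewrite big_nat_recr//=; apply: le_trans (lerD IH (lexx _)) _.
rewrite -addrA lerD2l addnS !addSn /f -lerBrDl opprK addrC -!natr1.
have : 0 <= (m + n)%:R :> R by []; move: (m + n)%:R => a a0.
rewrite (_ : _ - _ = ((a + 1) * ((a + 1 + 1) * (a + 1 + 1 + 1)))^-1); last first.
  by field; rewrite !gt_eqF//; lra.
have p1 : 0 < a + 1 by lra.
have p2 : 0 < a + 1 + 1 by lra.
have p3 : 0 < a + 1 + 1 + 1 by lra.
by rewrite lef_pV2 ?posrE ?mulr_gt0 ?exprn_gt0// !exprS expr0; nra.
Qed.

Lemma weight_le (R : realType) q : weight R q <= (q%:R ^+ 3)^-1.
Proof.
case: q => [|q]; first by rewrite weight0 invr_ge0 exprn_ge0.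
have := hsum_seq_le (s := [:: q.+1]) (hsum_totient R (ltn0Sn q)) isT.
rewrite big_seq1 dvdnn mul1r /weight => h.
have q0 : 0 < q.+1%:R :> R by [].
rewrite ler_pdivrMr ?exprn_gt0// (exprSr _ 3) mulKf// gt_eqF// exprn_gt0//.
Qed.

Lemma weight1 (R : realType) : weight R 1 = 1.
Proof. by rewrite /weight expr1n divr1. Qed.

(** Used with the mean s = B / A for the Cauchy-Schwarz inequality, and with s = A for the
    quantitative bound. *)
Lemma spectral_variance (R : realType) N (h : nat -> R) A B C s : 0 <= s ->
  spectral N h A B C ->
  hsum (fun q => sifted_weight R N q * (h q - s) ^+ 2) (C + s ^+ 2 * A - 2 * s * B).
Proof.
move=> s0 [hA _ hB hC].
have s2 : 0 <= 2 * s by exact: mulr_ge0.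
have le q : 2 * s * (sifted_weight R N q * h q) <=
    sifted_weight R N q * h q ^+ 2 + s ^+ 2 * sifted_weight R N q.
  rewrite -subr_ge0 (_ : _ - _ = sifted_weight R N q * (h q - s) ^+ 2); last by ring.
  by rewrite mulr_ge0 ?sifted_weight_ge0 ?sqr_ge0.
apply: hsum_ext (hsumB le (hsumZ s2 hB) (hsumD hC (hsumZ (sqr_ge0 s) hA))) => q.
by ring.
Qed.

Lemma spectral_A_ge1 (R : realType) N (h : nat -> R) A B C :
  spectral N h A B C -> 1 <= A.
Proof.
move=> [hA _ _ _]; have := hsum_seq_le (s := [:: 1%N]) hA isT.
by rewrite big_seq1 /sifted_weight coprimen1 mul1r weight1.
Qed.

(** A gcd is at least 1, so h >= A everywhere. *)
Lemma spectral_B_ge (R : realType) N (h : nat -> R) A B C :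
  spectral N h A B C -> A ^+ 2 <= B.
Proof.
move=> sp; have A1 := spectral_A_ge1 sp; case: sp => hA hh hB _.
have A0 : 0 <= A by lra.
apply: hsum_le (hsumZ A0 hA) hB => q; rewrite mulrC.
have [->|q0] := posnP q; first by rewrite sifted_weight0 !mul0r.
case: (boolP (coprime N q)) => cq; last by rewrite /sifted_weight (negbTE cq) !mul0r.
rewrite ler_wpM2l ?sifted_weight_ge0//.
apply: hsum_le hA (hh q q0 cq) => e; rewrite ler_peMr ?sifted_weight_ge0//.
by rewrite exprn_ege1// ler1n gcdn_gt0 q0 orbT.
Qed.

Lemma spectral_cauchy_schwarz (R : realType) N (h : nat -> R) A B C :
  spectral N h A B C -> B ^+ 2 <= A * C.
Proof.
move=> sp; have A1 := spectral_A_ge1 sp; have B1 := spectral_B_ge sp.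
have A0 : 0 < A by lra.
have B0 : 0 <= B by apply: le_trans B1; exact: sqr_ge0.
have := hsum_ge0 (spectral_variance (divr_ge0 B0 (ltW A0)) sp).
move=> /(mulr_ge0 (ltW A0)).
have -> : A * (C + (B / A) ^+ 2 * A - 2 * (B / A) * B) = A * C - B ^+ 2.
  by field; rewrite gt_eqF.
by rewrite subr_ge0.
Qed.

Section Variance.
Variables (R : realType) (N : nat).
Hypothesis N11 : forall g, (1 < g)%N -> coprime N g -> (10 < g)%N.

Let chi (g : nat) : R := ((1 < g)%N && coprime N g)%:R.

Let chi_ge0 g : 0 <= chi g.
Proof. exact: ler0n. Qed.

Let chi_le g : chi g <= (10 < g)%:R.
Proof.
rewrite /chi; case: (ltnP 1 g) => //= g1; case: (boolP (coprime N g)) => //= c.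
by rewrite N11.
Qed.

Let x g := chi g * (g%:R ^+ 4)^-1.
Let x_ge0 g : 0 <= x g.
Proof. by rewrite mulr_ge0// invr_ge0 exprn_ge0. Qed.

(** Bound gcd(a, b)^3 by the sum of f^3 over the common divisors f prime to N, of which the gcd is
    one. The double sum becomes the sum of f^3 X_f^2, with X_f the sum of [x] over the multiples of
    f. For f = 1, X_1 <= t3 / 11; every other f is at least 11, and f^3 (z4 / f^4)^2 <= (z4^2 / 121)
    f^(-3). *)
Lemma hsum_gcd_cube (z4 t3 : R) :
  hsum (fun k => (k%:R ^+ 4)^-1) z4 ->
  hsum (fun k => (10 < k)%:R * (k%:R ^+ 3)^-1) t3 ->
  exists2 T, hsum (fun p : nat * nat => x p.1 * x p.2 * (gcdn p.1 p.2)%:R ^+ 3) T &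
    T <= (t3 / 11) ^+ 2 + z4 ^+ 2 / 121 * t3.
Proof.
move=> h4 h3; have z40 := hsum_ge0 h4.
have HX f : exists2 X, hsum (fun g => (f %| g)%:R * x g) X &
    [/\ f = 1%N -> X <= t3 / 11 & (0 < f)%N -> X <= z4 / f%:R ^+ 4].
  have xle g : x g <= (g%:R ^+ 4)^-1.
    by rewrite ler_piMl ?invr_ge0 ?exprn_ge0// /chi; case: (_ && _).
  have [|X hX _] := hsum_dom _ h4 (f := fun g => (f %| g)%:R * x g).
    by move=> g; rewrite mulr_ge0//=; case: (f %| g)%N; rewrite ?mul0r ?mul1r ?xle// invr_ge0 exprn_ge0.
  exists X => //; split => [f1|f0].
    have n11 : 0 <= 11^-1 :> R by [].
    rewrite mulrC; apply: hsum_le hX (hsumZ n11 h3) => g.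
    rewrite f1 dvd1n mul1r mulrCA; apply: le_trans (_ : (10 < g)%:R * (g%:R ^+ 4)^-1 <= _).
      by rewrite ler_wpM2r ?invr_ge0 ?exprn_ge0.
    case: (ltnP 10 g) => g11; last by rewrite !mul0r.
    rewrite !mul1r (exprS _ 3) invfM ler_wpM2r ?invr_ge0 ?exprn_ge0//.
    by rewrite lef_pV2 ?posrE ?ltr0n ?(leq_trans _ g11)// ler_nat.
  apply: hsum_le hX (hsum_inv_pow_multiples f0 (isT : (0 < 4)%N) h4) => g.
  by rewrite ler_wpM2l.
have {HX}/choice[X hX] f : exists X, hsum (fun g => (f %| g)%:R * x g) X /\
    (f = 1%N -> X <= t3 / 11) /\ ((0 < f)%N -> X <= z4 / f%:R ^+ 4).
  by have [X h1 [h2 h3']] := HX f; exists X.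
pose F f (p : nat * nat) : R := (coprime N f)%:R * f%:R ^+ 3 *
  (((f %| p.1)%:R * x p.1) * ((f %| p.2)%:R * x p.2)).
pose r f := (coprime N f)%:R * f%:R ^+ 3 * (X f * X f).
have hF f : hsum (F f) (r f).
  apply: hsumZ; first by rewrite mulr_ge0 ?exprn_ge0.
  exact: hsum_prod (hX f).1 (hX f).1.
have z4c : 0 <= z4 ^+ 2 / 121 by rewrite divr_ge0 ?sqr_ge0.
have hone : hsum (fun f => (f == 1%N)%:R * (t3 / 11) ^+ 2) ((t3 / 11) ^+ 2).
  have := @hsum_fin R nat (fun f => (f == 1%N)%:R * (t3 / 11) ^+ 2) [:: 1%N] isT.
  rewrite big_seq1 eqxx mul1r; apply=> [i|i]; first by rewrite mulr_ge0 ?sqr_ge0.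
  by rewrite inE => /negbTE ->; rewrite mul0r.
have [|l hl ll] := hsum_dom _ (hsumD hone (hsumZ z4c h3)) (f := r).
  move=> f; have X0 := hsum_ge0 (hX f).1.
  rewrite /r !mulr_ge0 ?exprn_ge0//=.
  have [->|f0] := posnP f.
    by rewrite expr0n/= mulr0 mul0r addr_ge0 ?mulr_ge0 ?sqr_ge0 ?invr_ge0 ?(hsum_ge0 h3)//= mul0r.
  case: (eqVneq f 1%N) => [f1|f1].
    rewrite f1 coprimen1 expr1n !mul1r (_ : (10 < 1)%N = false)// mul0r mulr0 addr0 expr2.
    have h := (hX f).2.1 f1; rewrite f1 in h X0.
    by apply: ler_pM.
  have f2 : (1 < f)%N by lia.
  case: (boolP (coprime N f)) => cf; last first.
    by rewrite !mul0r add0r mulr_ge0// mulr_ge0// invr_ge0 exprn_ge0.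
  have f11 := N11 f2 cf; rewrite f11 !mul1r mul0r add0r.
  have fR : 11 <= f%:R :> R by rewrite ler_nat.
  have f0R : 0 < f%:R :> R by lra.
  apply: le_trans (_ : f%:R ^+ 3 * ((z4 / f%:R ^+ 4) * (z4 / f%:R ^+ 4)) <= _).
    by rewrite ler_wpM2l ?exprn_ge0 ?ler_pM ?(hX f).2.2// ltW.
  rewrite (_ : _ * _ = z4 ^+ 2 / f%:R ^+ 2 * (f%:R ^+ 3)^-1); last by field; rewrite gt_eqF.
  have i3 : 0 <= (f%:R ^+ 3)^-1 :> R by rewrite invr_ge0 exprn_ge0.
  rewrite ler_wpM2r// ler_wpM2l ?sqr_ge0//.
  by rewrite lef_pV2 ?posrE ?exprn_gt0// expr2; nra.
have [s hs hsl] := hsum_cols hF hl.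
have [|T hT Tl] := hsum_dom _ hsl (f := fun p : nat * nat => x p.1 * x p.2 * (gcdn p.1 p.2)%:R ^+ 3).
  move=> [a b] /=; rewrite !mulr_ge0 ?exprn_ge0//=.
  have := hsum_seq_le (s := [:: gcdn a b]) (hs (a, b)) isT; apply: le_trans.
  rewrite big_seq1 /F /= dvdn_gcdl dvdn_gcdr !mul1r.
  case: (boolP (coprime N (gcdn a b))) => c; first by rewrite mul1r mulrC.
  suff -> : x a = 0 by rewrite !mul0r.
  rewrite /x /chi; case: (boolP (coprime N a)) => ca; last by rewrite andbF mul0r.
  by rewrite (coprime_dvdr (dvdn_gcdl a b) ca) in c.
by exists T => //; exact: le_trans Tl ll.
Qed.

(** In h(q) - A only the e with g = gcd(e, q) > 1 count. Bounding w(e) by e^(-3) and summing over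
    the multiples e of g gives h(q) - A <= z3 D(q), where D(q) is the sum of 1/g over the divisors g
    > 1 of q prime to N. Squaring and summing against q^(-3) yields 1 / (a b lcm(a, b)^3) = gcd(a,
    b)^3 / (a b)^4, the sum bounded in [hsum_gcd_cube]. *)
Lemma spectral_variance_le (h : nat -> R) A B C z3 z4 t3 :
  hsum (fun k => (k%:R ^+ 3)^-1) z3 ->
  hsum (fun k => (k%:R ^+ 4)^-1) z4 ->
  hsum (fun k => (10 < k)%:R * (k%:R ^+ 3)^-1) t3 ->
  spectral N h A B C ->
  C + A ^+ 2 * A - 2 * A * B <= z3 ^+ 3 * ((t3 / 11) ^+ 2 + z4 ^+ 2 / 121 * t3).
Proof.
move=> h3 h4 ht sp; have z30 := hsum_ge0 h3.
have A1 := spectral_A_ge1 sp; have A0 : 0 <= A by lra.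
have hV := spectral_variance A0 sp; have [hA hh _ _] := sp.
have [T hT Tle] := hsum_gcd_cube h4 ht.
pose y g := chi g * (g%:R)^-1.
have y0 g : 0 <= y g by rewrite mulr_ge0// invr_ge0.
pose D q := \sum_(g <- divisors q) (g %| q)%:R * y g.
have hD q : (0 < q)%N -> hsum (fun g => (g %| q)%:R * y g) (D q).
  move=> q0; apply: hsum_fin => [|g|g]; rewrite ?divisors_uniq ?mulr_ge0//.
  by rewrite -dvdn_divisors// => /negbTE ->; rewrite mul0r.
have D0 q : 0 <= D q by apply: sumr_ge0 => g _; rewrite mulr_ge0.
have hD2 : hsum (fun q => (q%:R ^+ 3)^-1 * (D q * D q)) (z3 * T).
  pose K (p : nat * nat) (q : nat) : R := y p.1 * y p.2 *
    ((lcmn p.1 p.2 %| q)%:R * (q%:R ^+ 3)^-1).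
  have hK p : hsum (K p) (z3 * (x p.1 * x p.2 * (gcdn p.1 p.2)%:R ^+ 3)).
    case: p => a b; rewrite /K /=.
    have [->|a0] := posnP a.
      by rewrite /y /x invr0 expr0n/= invr0 !(mulr0, mul0r); apply: hsum_ext (hsum0 _ _) => q; rewrite mul0r.
    have [->|b0] := posnP b.
      by rewrite /y /x invr0 expr0n/= invr0 !(mulr0, mul0r); apply: hsum_ext (hsum0 _ _) => q; rewrite mul0r.
    have l0 : (0 < lcmn a b)%N by rewrite lcmn_gt0 a0.
    rewrite (_ : z3 * _ = y a * y b * (z3 / (lcmn a b)%:R ^+ 3)).
      apply: hsumZ; first by rewrite mulr_ge0.
      exact: (hsum_inv_pow_multiples l0 (isT : (0 < 3)%N) h3).
    have -> : (gcdn a b)%:R = a%:R * b%:R / (lcmn a b)%:R :> R.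
      by rewrite -natrM -muln_lcm_gcd natrM mulrAC mulfV ?mul1r// pnatr_eq0 -lt0n.
    by rewrite /x /y; field; rewrite !pnatr_eq0 -!lt0n l0 a0 b0.
  apply: (hsum_swap (f := K)) (hsumZ z30 hT) => // -[|q]; rewrite /K.
    rewrite expr0n/= invr0 mul0r; apply: hsum_ext (hsum0 _ _) => p.
    by rewrite !mulr0.
  have q30 : 0 <= (q.+1%:R ^+ 3)^-1 :> R by rewrite invr_ge0 exprn_ge0.
  apply: hsum_ext (hsumZ q30 (hsum_prod (hD _ (ltn0Sn q)) (hD _ (ltn0Sn q)))) => -[a b] /=.
  by rewrite dvdn_lcm; case: (a %| _)%N; case: (b %| _)%N => /=; ring.
have hle q : (0 < q)%N -> coprime N q -> 0 <= h q - A <= z3 * D q.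
  move=> q0 cq.
  have le1 e : sifted_weight R N e <= sifted_weight R N e * (gcdn e q)%:R ^+ 2.
    rewrite ler_peMr ?sifted_weight_ge0//.
    by rewrite exprn_ege1// ler1n gcdn_gt0 q0 orbT.
  have hB := hsumB le1 hA (hh q q0 cq).
  rewrite (hsum_ge0 hB)/=.
  pose E (g e : nat) : R := (g %| q)%:R * y g * g%:R ^+ 3 * ((g %| e)%:R * (e%:R ^+ 3)^-1).
  have E0 g : 0 <= (g %| q)%:R * y g * g%:R ^+ 3.
    by rewrite mulr_ge0 ?exprn_ge0// mulr_ge0.
  have hE g : hsum (E g) (z3 * ((g %| q)%:R * y g)).
    have [->|g0] := posnP g.
      rewrite /E /y invr0 !mulr0; apply: hsum_ext (hsum0 _ _) => e; by rewrite !mul0r.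
    rewrite (_ : z3 * _ = (g %| q)%:R * y g * g%:R ^+ 3 * (z3 / g%:R ^+ 3)).
      by apply: hsumZ => //; exact: (hsum_inv_pow_multiples g0 (isT : (0 < 3)%N) h3).
    by field; rewrite pnatr_eq0 -lt0n.
  have [r hr hrl] := hsum_cols hE (hsumZ z30 (hD q q0)).
  apply: hsum_le hB hrl => e.
  have := hsum_seq_le (s := [:: gcdn e q]) (hr e) isT; apply: le_trans.
  rewrite big_seq1 /E dvdn_gcdl dvdn_gcdr !mul1r.
  set g := gcdn e q; have g0 : (0 < g)%N by rewrite gcdn_gt0 q0 orbT.
  have e3 : 0 <= (e%:R ^+ 3)^-1 :> R by rewrite invr_ge0 exprn_ge0.
  have [g1|g1] := eqVneq g 1%N.
    by rewrite g1 expr1n mulr1 subrr mulr_ge0// mulr_ge0.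
  have cg : coprime N g by apply: coprime_dvdr (dvdn_gcdr e q) cq.
  have yE : y g = g%:R^-1 by rewrite /y /chi cg andbT (_ : (1 < g)%N) ?mul1r//; lia.
  rewrite yE (exprS g%:R 2) mulKf ?pnatr_eq0 -?lt0n//.
  apply: le_trans (_ : sifted_weight R N e * g%:R ^+ 2 <= _).
    by rewrite gerBl sifted_weight_ge0.
  rewrite [leLHS]mulrC ler_wpM2l ?exprn_ge0//; apply: le_trans (weight_le R e).
  by rewrite /sifted_weight; case: (coprime N e); rewrite ?mul1r// mul0r weight_ge0.
have hV2 := hsumZ (sqr_ge0 z3) hD2.
apply: le_trans (hsum_le _ hV hV2) _; last first.
  by rewrite (exprSr _ 2) -[leRHS]mulrA ler_wpM2l ?sqr_ge0// ler_wpM2l.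
move=> q; have [->|q0] := posnP q.
  rewrite sifted_weight0 mul0r mulr_ge0 ?sqr_ge0//.
  by rewrite mulr_ge0 ?invr_ge0 ?exprn_ge0 ?mulr_ge0.
case: (boolP (coprime N q)) => cq; last first.
  rewrite /sifted_weight (negbTE cq) !mul0r mulr_ge0 ?sqr_ge0//.
  by rewrite mulr_ge0 ?invr_ge0 ?exprn_ge0 ?mulr_ge0.
have /andP[hq0 hq] := hle q q0 cq.
rewrite /sifted_weight cq mul1r (mulrCA (z3 ^+ 2)).
apply: ler_pM; rewrite ?weight_ge0 ?sqr_ge0 ?weight_le//.
rewrite (_ : z3 ^+ 2 * _ = (z3 * D q) ^+ 2); last by ring.
by rewrite lerXn2r ?nnegrE// mulr_ge0.
Qed.

End Variance.

(** If V is the variance around A, then A C = A V + 2 A^2 B - A^4 <= A V + B^2, as (B - A^2)^2 >= 0.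
    With V <= d this gives A C <= (1 + d) B^2, and (1 - d)(1 + d) <= 1. *)
Lemma spectral_lower_bound (R : realType) N (h : nat -> R) A B C :
  (forall g, (1 < g)%N -> coprime N g -> (10 < g)%N) ->
  spectral N h A B C -> (1 - 116 / 10 ^+ 6) * (A * C) <= B ^+ 2.
Proof.
move=> N11 sp.
have [z3 h3] := @hsum_inv_pow R 3 isT; have [z4 h4] := @hsum_inv_pow R 4 isT.
have [t3 ht t3le] := hsum_tail_cube R 9; have [t2 ht2 t2le] := hsum_tail_cube R 0.
have t30 := hsum_ge0 ht; have z30 := hsum_ge0 h3; have z40 := hsum_ge0 h4.
have z3le : z3 <= 5 / 4.
  have hone : hsum (fun f => (f == 1%N)%:R : R) 1.
    have := @hsum_fin R nat (fun f => (f == 1%N)%:R) [:: 1%N] isT.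
    rewrite big_seq1 eqxx; apply=> [i|i] //.
    by rewrite inE => /negbTE ->.
  have : z3 <= 1 + t2.
    apply: hsum_le h3 (hsumD hone ht2) => -[|[|k]].
    - by rewrite expr0n/= invr0 addr_ge0// mulr0.
    - by rewrite expr1n invr1 eqxx lerDl mulr_ge0.
    - by rewrite mul1r lerDr.
  by move: t2le; rewrite mulr1 (_ : (2 * 2)^-1 = 1 / 4 :> R); [lra|field].
have z43 : z4 <= z3.
  apply: hsum_le h4 h3 => -[|k]; first by rewrite !expr0n.
  rewrite lef_pV2 ?posrE ?exprn_gt0//; apply: ler_weXn2l => //.
  by rewrite ler1n.
have {}t3le : t3 <= 1 / 220.
  by move: t3le; rewrite (_ : (2 * 11 * 10)^-1 = 1 / 220 :> R) //; field.
have := spectral_variance_le N11 h3 h4 ht sp.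
set V := C + _ - _ => Vle.
have {Vle} V1 : V <= 116 / 10 ^+ 6.
  apply: le_trans Vle _.
  (* The numerical value is about 1.1498e-4, rounded up to 116 / 10^6. *)
  apply: le_trans (_ : (5 / 4) ^+ 3 * ((1 / 220 / 11) ^+ 2 + (5 / 4) ^+ 2 / 121 * (1 / 220)) <= _).
    apply: ler_pM; rewrite ?exprn_ge0//.
    - by rewrite addr_ge0 ?sqr_ge0// mulr_ge0// divr_ge0// sqr_ge0.
    - by rewrite lerXn2r ?nnegrE//; lra.
    apply: lerD.
      by rewrite lerXn2r ?nnegrE ?divr_ge0// ler_pM2r.
    apply: ler_pM; rewrite ?divr_ge0 ?sqr_ge0//.
    by rewrite ler_pM2r// lerXn2r ?nnegrE//; lra.
  by rewrite !exprS expr0; lra.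
have A1 := spectral_A_ge1 sp; have B1 := spectral_B_ge sp.
have CE : C = V + 2 * A * B - A ^+ 2 * A by rewrite /V; ring.
have d0 : 0 <= 116 / 10 ^+ 6 :> R by rewrite divr_ge0// exprn_ge0.
have d1 : 116 / 10 ^+ 6 <= 1 :> R by rewrite !exprS expr0; lra.
move: (116 / 10 ^+ 6) V1 d0 d1 => d V1 d0 d1.
(* From 1 <= A <= A^4 <= B^2; it turns the error A d into the relative error d B^2. *)
have A2B : A <= B ^+ 2.
  apply: le_trans (_ : (A ^+ 2) ^+ 2 <= _).
    by rewrite -exprM; apply: le_trans (ler_weXn2l A1 (isT : (1 <= 2 * 2)%N)).
  by rewrite lerXn2r ?nnegrE ?sqr_ge0// (le_trans _ B1)// sqr_ge0.
have AC : A * C <= (1 + d) * B ^+ 2.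
  rewrite CE (_ : A * _ = A * V + (2 * A ^+ 2 * B - A ^+ 4)); last by ring.
  have : A * V <= A * d by rewrite ler_wpM2l//; lra.
  have : A * d <= B ^+ 2 * d by rewrite ler_wpM2r.
  have : 0 <= (B - A ^+ 2) ^+ 2 by rewrite sqr_ge0.
  rewrite (_ : (B - A ^+ 2) ^+ 2 = B ^+ 2 - (2 * A ^+ 2 * B - A ^+ 4)); last by ring.
  lra.
have d1' : 0 <= 1 - d by lra.
apply: le_trans (ler_wpM2l d1' AC) _.
rewrite mulrA (_ : (1 - d) * (1 + d) = 1 - d ^+ 2); last by ring.
by rewrite ler_piMl ?sqr_ge0// gerBl sqr_ge0.
Qed.

(** * Numerical bounds *)

(** At x = 1/2 the ratio B^2 / (A C) is an explicit rational near 1 - 0.0028282. It is enclosed by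
    decimals to keep the final product small, and written without division so that enclosures
    multiply. *)
Lemma local_ratio_2 (R : realType) (x := 2%:R^-1 : R) :
  0 <= (1 - 2829 / 10 ^+ 6 : R) < 1 - 2828 / 10 ^+ 6 /\
  (1 - 2829 / 10 ^+ 6) * (local_A x * local_C x) <= local_B x ^+ 2
    <= (1 - 2828 / 10 ^+ 6) * (local_A x * local_C x).
Proof.
have g0 : geo x 0 = 15 / 14 by rewrite /geo /x; field.
have g1 : geo x 1 = 31 / 30 by rewrite /geo /x; field.
have g2 : geo x 2 = 63 / 62 by rewrite /geo /x; field.
have v : local_v x = 3 / 7 by rewrite /local_v /x; field.
have u : local_u x = 15 / 14 + 3 / 7 by rewrite /local_u -/(local_v x) g0 v.
split; first by rewrite !exprS expr0; lra.
by rewrite /local_A /local_B /local_C u v g0 g1 g2 !exprS expr0; lra.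
Qed.

Lemma local_ratio_3 (R : realType) (x := 3%:R^-1 : R) :
  0 <= (1 - 993 / 10 ^+ 6 : R) < 1 - 992 / 10 ^+ 6 /\
  (1 - 993 / 10 ^+ 6) * (local_A x * local_C x) <= local_B x ^+ 2
    <= (1 - 992 / 10 ^+ 6) * (local_A x * local_C x).
Proof.
have g0 : geo x 0 = 40 / 39 by rewrite /geo /x; field.
have g1 : geo x 1 = 121 / 120 by rewrite /geo /x; field.
have g2 : geo x 2 = 364 / 363 by rewrite /geo /x; field.
have v : local_v x = 4 / 13 by rewrite /local_v /x; field.
have u : local_u x = 40 / 39 + 4 / 13 by rewrite /local_u -/(local_v x) g0 v.
split; first by rewrite !exprS expr0; lra.
by rewrite /local_A /local_B /local_C u v g0 g1 g2 !exprS expr0; lra.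
Qed.

Lemma local_ratio_5 (R : realType) (x := 5%:R^-1 : R) :
  0 <= (1 - 1510 / 10 ^+ 7 : R) < 1 - 1509 / 10 ^+ 7 /\
  (1 - 1510 / 10 ^+ 7) * (local_A x * local_C x) <= local_B x ^+ 2
    <= (1 - 1509 / 10 ^+ 7) * (local_A x * local_C x).
Proof.
have g0 : geo x 0 = 156 / 155 by rewrite /geo /x; field.
have g1 : geo x 1 = 781 / 780 by rewrite /geo /x; field.
have g2 : geo x 2 = 3906 / 3905 by rewrite /geo /x; field.
have v : local_v x = 6 / 31 by rewrite /local_v /x; field.
have u : local_u x = 156 / 155 + 6 / 31 by rewrite /local_u -/(local_v x) g0 v.
split; first by rewrite !exprS expr0; lra.
by rewrite /local_A /local_B /local_C u v g0 g1 g2 !exprS expr0; lra.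
Qed.

Lemma local_ratio_7 (R : realType) (x := 7%:R^-1 : R) :
  0 <= (1 - 360 / 10 ^+ 7 : R) < 1 - 359 / 10 ^+ 7 /\
  (1 - 360 / 10 ^+ 7) * (local_A x * local_C x) <= local_B x ^+ 2
    <= (1 - 359 / 10 ^+ 7) * (local_A x * local_C x).
Proof.
have g0 : geo x 0 = 400 / 399 by rewrite /geo /x; field.
have g1 : geo x 1 = 2801 / 2800 by rewrite /geo /x; field.
have g2 : geo x 2 = 1 + 1 / (7 * 2801) by rewrite /geo /x; field.
have v : local_v x = 8 / 57 by rewrite /local_v /x; field.
have u : local_u x = 400 / 399 + 8 / 57 by rewrite /local_u -/(local_v x) g0 v.
split; first by rewrite !exprS expr0; lra.
by rewrite /local_A /local_B /local_C u v g0 g1 g2 !exprS expr0; lra.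
Qed.

(** The strict inequality l < u is what forces M >= 0, so no sign condition on M has to be carried
    along. *)
Lemma ratio_mul (R : realType) (l1 u1 l2 u2 M1 M2 Q1 Q2 : R) :
  0 <= l1 < u1 /\ l1 * M1 <= Q1 <= u1 * M1 ->
  0 <= l2 < u2 /\ l2 * M2 <= Q2 <= u2 * M2 ->
  0 <= l1 * l2 < u1 * u2 /\ (l1 * l2) * (M1 * M2) <= Q1 * Q2 <= (u1 * u2) * (M1 * M2).
Proof.
have M0 (l u M Q : R) : l < u -> l * M <= Q <= u * M -> 0 <= M.
  move=> lu /andP[h1 h2]; have := le_trans h1 h2.
  by rewrite -subr_ge0 -mulrBl pmulr_rge0// subr_gt0.
move=> [/andP[l10 lu1] r1] [/andP[l20 lu2] r2].
have M10 := M0 _ _ _ _ lu1 r1; have M20 := M0 _ _ _ _ lu2 r2.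
move: r1 r2 => /andP[a1 b1] /andP[a2 b2].
split; first by rewrite mulr_ge0// ltr_pM.
have E (l u : R) : l * u * (M1 * M2) = (l * M1) * (u * M2) by ring.
rewrite !E !ler_pM ?mulr_ge0//.
- by apply: le_trans a1; rewrite mulr_ge0.
- by apply: le_trans a2; rewrite mulr_ge0.
Qed.

Lemma alpha_bounds (R : realType) (h : nat -> R) A B C :
  spectral 1 h A B C ->
  (9979 / 10 ^+ 4) ^+ 2 * (A * C) <= B ^+ 2 < (998 / 10 ^+ 3) ^+ 2 * (A * C).
Proof.
move=> sp1.
have M0 : 0 < A * C.
  apply: lt_le_trans (spectral_cauchy_schwarz sp1); rewrite exprn_gt0//.
  apply: lt_le_trans (spectral_B_ge sp1); rewrite exprn_gt0//.
  exact: lt_le_trans (spectral_A_ge1 sp1).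
have [h2 [A2 [B2 [C2 [sp2 [eA2 eB2 eC2]]]]]] := spectral_strip (isT : prime 2) (isT : coprime 2 1) sp1.
have [h3 [A3 [B3 [C3 [sp3 [eA3 eB3 eC3]]]]]] :=
  spectral_strip (isT : prime 3) (isT : coprime 3 (2 * 1)) sp2.
have [h5 [A5 [B5 [C5 [sp5 [eA5 eB5 eC5]]]]]] :=
  spectral_strip (isT : prime 5) (isT : coprime 5 (3 * (2 * 1))) sp3.
have [h7 [A7 [B7 [C7 [sp7 [eA7 eB7 eC7]]]]]] :=
  spectral_strip (isT : prime 7) (isT : coprime 7 (5 * (3 * (2 * 1)))) sp5.
have N11 g : (1 < g)%N -> coprime (7 * (5 * (3 * (2 * 1)))) g -> (10 < g)%N.
  by case: (leqP g 10) => //; do 11 (case: g => [//|g]).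
have r : 0 <= (1 - 116 / 10 ^+ 6 : R) < 1 /\
    (1 - 116 / 10 ^+ 6) * (A7 * C7) <= B7 ^+ 2 <= 1 * (A7 * C7).
  split; first by rewrite !exprS expr0; lra.
  rewrite mul1r (spectral_cauchy_schwarz sp7) andbT.
  exact: spectral_lower_bound N11 sp7.
have [_ /andP[]] := ratio_mul (local_ratio_2 R) (ratio_mul (local_ratio_3 R)
  (ratio_mul (local_ratio_5 R) (ratio_mul (local_ratio_7 R) r))).
set M := _ * (_ * (_ * (_ * (A7 * C7)))); set Q := _ * (_ * (_ * (_ * B7 ^+ 2))).
have -> : M = A * C by rewrite eA2 eC2 eA3 eC3 eA5 eC5 eA7 eC7 /M; ring.
have -> : Q = B ^+ 2 by rewrite eB2 eB3 eB5 eB7 /Q; ring.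
move=> lo up; apply/andP; split.
  apply: le_trans lo; rewrite ler_wpM2r ?(ltW M0)// !exprS expr0; lra.
apply: le_lt_trans up _; rewrite ltr_pM2r// !exprS expr0; lra.
Qed.

(** * Assembling the limit, the formula and the numerical value *)

Lemma powRN3 (R : realType) (k : nat) : (k%:R : R) `^ (- 3) = (k%:R ^+ 3)^-1.
Proof. by rewrite powRN powR_mulrn. Qed.

Lemma cvg_zeta3 (R : realType) (z3 : R) : hsum (fun k => (k%:R ^+ 3)^-1 : R) z3 ->
  (fun N => \sum_(1 <= k < N) (k%:R : R) `^ (- 3)) @ \oo --> z3.
Proof.
move=> h3; have := hsum_series h3; rewrite expr0n/= invr0 => /(_ erefl).
by under [X in _ -> X @ _ --> _]eq_fun do under eq_bigr do rewrite powRN3.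
Qed.

Lemma gcd_formE (R : realType) (G : R) :
  hsum (fun p : nat * nat => (gcd_coef R p.1 / p.1%:R ^+ 2) *
    (gcd_coef R p.2 / p.2%:R ^+ 2) * (gcdn p.1 p.2)%:R) G ->
  gcd_form R = G%:E.
Proof.
move=> [_ <-]; rewrite /gcd_form esum_mkcond; apply: eq_esum => -[a b] _ /=.
case: ifPn => [_|]; first by congr EFin; rewrite invfM; ring.
rewrite notin_setE /= => nab; congr EFin.
case: a b nab => [|a] [|b] nab; rewrite ?expr0n/= ?invr0 ?(mulr0, mul0r)//.
by exfalso; apply: nab.
Qed.

Theorem theorem1 (R : realType) :
  [/\ (* the infinite sums in the formula converge *)
      cvgn (fun N => \sum_(1 <= k < N) (k%:R : R) `^ (- 3)),
      (forall d : nat, (0 < d)%N ->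
         cvgn (fun N => \sum_(1 <= m < N) ((gcdn m d)%:R / m%:R ^+ 2 : R))),
      cvgn (fun N => \sum_(1 <= d < N) (gcd_coef R d ^+ 2 / d%:R ^+ 2)),
      (gcd_form R \is a fin_num) &
      exists alpha : R,
        [/\ (fun n : nat =>
               let A := redheffer R n in
               let v := sigma_vec R n in
               let w := A^T *m A *m v in
               inner ((enorm v)^-1 *: v) ((enorm w)^-1 *: w)) @ \oo --> alpha,
            alpha = Num.sqrt 2 / (Num.sqrt 5 * Num.sqrt (zeta 3))
                    * limn (fun N => \sum_(1 <= d < N) (gcd_coef R d ^+ 2 / d%:R ^+ 2))
                    * (fine (gcd_form R)) `^ (- 2^-1) &
            (* alpha = 0.9979... *)
            9979 / 10 ^+ 4 <= alpha < 998 / 10 ^+ 3]].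
Proof.
have [z2 h2] := @hsum_inv_pow R 2 isT; have [z3 h3] := @hsum_inv_pow R 3 isT.
have [z4 h4] := @hsum_inv_pow R 4 isT.
have [V hV] := hsum_gcd_sqr R; have [S hS] := hsum_gcd_coef_sqr R.
have [G hG] := hsum_gcd_form R.
have [A [B [C [h [hA hh [hB hC] [VE SE GE] Az]]]]] := spectral_form h2 h3 h4 hV hS hG.
have cz := cvg_zeta3 h3.
have cS := hsum_series hS; rewrite expr0n/= invr0 mulr0 in cS; have {}cS := cS erefl.
have cc d : (0 < d)%N -> (fun N => \sum_(1 <= m < N) ((gcdn m d)%:R / m%:R ^+ 2 : R)) @ \oo
    --> gcd_coef R d.
  move=> d0; have := hsum_series (hsum_gcd_coef R d0).
  by rewrite expr0n/= invr0 mulr0 => /(_ erefl).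
have sp : spectral 1 h A B C.
  have w1 q : weight R q = sifted_weight R 1 q.
    by rewrite /sifted_weight coprime1n mul1r.
  split.
  - exact: hsum_ext hA.
  - by move=> q q0 _; apply: hsum_ext (hh q q0) => e; rewrite w1.
  - by apply: hsum_ext hB => q; rewrite w1.
  - by apply: hsum_ext hC => q; rewrite w1.
have A1 := spectral_A_ge1 sp.
have z20 : 0 < z2.
  have := hsum_seq_le (s := [:: 1%N]) h2 isT; rewrite big_seq1 expr1n invr1.
  exact: lt_le_trans.
have B1 : 1 <= B.
  by apply: le_trans (spectral_B_ge sp); rewrite exprn_ege1.
have C0 : 0 < C.
  rewrite -(@pmulr_rgt0 _ A) ?(lt_le_trans ltr01 A1)//.
  apply: lt_le_trans (spectral_cauchy_schwarz sp); rewrite exprn_gt0//.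
  exact: lt_le_trans ltr01 B1.
have A0 : 0 < A := lt_le_trans ltr01 A1.
have B0 : 0 < B := lt_le_trans ltr01 B1.
have V0 : 0 < V by rewrite VE mulr_gt0 ?exprn_gt0.
have G0 : 0 < G by rewrite GE mulr_gt0 ?exprn_gt0.
have S0 : 0 < S by rewrite SE mulr_gt0 ?exprn_gt0.
have z30 : 0 < z3.
  have := hsum_seq_le (s := [:: 1%N]) h3 isT; rewrite big_seq1 expr1n invr1.
  exact: lt_le_trans.
have V5 : V * 2 = 5 * z3.
  by rewrite VE -Az mulrAC (mulrC _ 2) (zeta2_sqr h2 h4); ring.
split.
- exact: cvgP cz.
- by move=> d d0; exact: cvgP (cc d d0).
- exact: cvgP cS.
- by rewrite (gcd_formE hG).
exists (S / (Num.sqrt V * Num.sqrt G)); split.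
- exact: cvg_cosine.
- rewrite (gcd_formE hG) /= /zeta (cvg_lim _ cz)// (cvg_lim _ cS)//.
  rewrite powRN powR12_sqrt ?(ltW G0)//.
  (* This replaces sqrt 2 / (sqrt 5 sqrt(zeta 3)) by 1 / sqrt V, after which the formula is the
     limit itself. *)
  have sV : Num.sqrt V * Num.sqrt 2 = Num.sqrt 5 * Num.sqrt z3.
    by rewrite -!sqrtrM ?V5// ltW.
  rewrite -sV.
  have s2 : Num.sqrt 2 != 0 :> R by rewrite gt_eqF// sqrtr_gt0.
  by field; rewrite s2 !gt_eqF ?sqrtr_gt0.
- have [lo up] := andP (alpha_bounds sp).
  have a0 : 0 <= S / (Num.sqrt V * Num.sqrt G) by rewrite divr_ge0 ?mulr_ge0 ?sqrtr_ge0 ?ltW.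
  (* The powers of zeta(2) cancel: S^2 carries the sixth, V the second and G the fourth. *)
  have a2 : (S / (Num.sqrt V * Num.sqrt G)) ^+ 2 = B ^+ 2 / (A * C).
    rewrite expr_div_n exprMn !sqr_sqrtr ?ltW// VE SE GE.
    by field; rewrite !gt_eqF.
  have AC0 : 0 < A * C by rewrite mulr_gt0.
  move: (S / _) a0 a2 => alpha a0 a2.
  have lb (l : R) : 0 <= l -> l ^+ 2 * (A * C) <= B ^+ 2 -> l <= alpha.
    by move=> l0 h'; rewrite -(@ler_pXn2r _ 2) ?nnegrE// a2 ler_pdivlMr.
  have ub (l : R) : 0 <= l -> B ^+ 2 < l ^+ 2 * (A * C) -> alpha < l.
    by move=> l0 h'; rewrite -(@ltr_pXn2r _ 2) ?nnegrE// a2 ltr_pdivrMr.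
  apply/andP; split.
    by apply: lb lo; apply: divr_ge0; rewrite ?exprn_ge0 ?ler0n.
  by apply: ub up; apply: divr_ge0; rewrite ?exprn_ge0 ?ler0n.
Qed.
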